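(* Let $G$ be a finite graph with distinct cospectral vertices $u,v\in V(G)$. Let $k\ge3$ be any odd integer, let $\mathbb{P}_k$ be the path on $k$ nodes with endpoints called $u,v$, and denote its central vertex by $w$. Let $A_G$ and $A_{\mathbb{P}_k}$ be the adjacency matrices. Add a transcendental potential $Q'\in\mathbb{R}$ to $w$ and then create $G'$ by gluing the path with this potential to the nodes $u$ and $v$ of $G$. Then putting on $u$ and $v$ a transcendental potential $Q\in\mathbb{R}$ that is algebraically independent from $Q'$ (over $\mathbb{Q}$) induces PGST from $u$ to $v$ in $G'$; i.e. the matrix $$N=\bigl(A_G\oplus(A_{\mathbb{P}_k}+Q'\cdot D_w)\bigr)+Q\cdot D_{uv}$$ has PGST from $u$ to $v$.
   Context: Vertices $u,v$ of $G$ are cospectral if the adjacency matrices of $G\setminus u$ and $G\setminus v$ have the same characteristic polynomial. The vertex sets of $G$ and $\mathbb{P}_k$ are taken to intersect exactly in $\{u,v\}$. For symmetric matrices $M_1,M_2$ with index sets satisfying $V(M_1)\cap V(M_2)=\{u,v\}$, $M_1\oplus M_2$ is the matrix indexed by $V(M_1)\cup V(M_2)$ obtained by extending each $M_i$ by zeros to $V(M_1)\cup V(M_2)$ and adding the two extensions (gluing). $D_S$ is the diagonal matrix with 1 in the positions belonging to $S$ and 0 elsewhere; $D_{uv}=D_{\{u,v\}}$, $D_w=D_{\{w\}}$. A real symmetric matrix $N$ has PGST (pretty good state transfer) from $u$ to $v$ if $\limsup_{t\to\infty}|(e^{itN})(u,v)|=1$. *)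

(* Defs.v *)
From HB Require Import structures.
From mathcomp Require Import all_boot all_order all_algebra all_real_closed.
From mathcomp Require Import all_classical all_reals all_analysis.

Set Implicit Arguments.
Unset Strict Implicit.
Unset Printing Implicit Defensive.

Import Order.TTheory GRing.Theory Num.Theory.
Import numFieldNormedType.Exports.
Local Open Scope ring_scope.

(* Finite simple graphs live inside an ambient finite type [T], so that two
   graphs may share vertices. *)
Record sgraph (T : finType) := SGraph {
  vset : {set T};
  adj : rel T;
  adj_sym : symmetric adj;
  adj_irr : irreflexive adj;
  adj_vset : forall x y, adj x y -> (x \in vset) && (y \in vset)
}.

Section Graphs.
Variable T : finType.

Section Deletion.
Variables (G : sgraph T) (u : T).

Definition del_adj : rel T :=
  [rel x y | [&& adj G x y, x != u & y != u]].

Lemma del_adj_sym : symmetric del_adj.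
Proof. by move=> x y; rewrite /del_adj /= (adj_sym G x y) [(x != u) && _]andbC. Qed.

Lemma del_adj_irr : irreflexive del_adj.
Proof. by move=> x; rewrite /del_adj /= (adj_irr G x). Qed.

Lemma del_adj_vset x y :
  del_adj x y -> (x \in vset G :\ u) && (y \in vset G :\ u).
Proof. by move=> /and3P[/adj_vset/andP[xG yG] xu yu]; rewrite !inE xu yu xG. Qed.

Definition del_vertex : sgraph T :=
  SGraph del_adj_sym del_adj_irr del_adj_vset.

End Deletion.

Section Path.
Variable p : seq T.

(* Meant for duplicate-free [p]: consecutive entries of [p] are adjacent. *)
Definition path_adj : rel T :=
  [rel x y | [&& x \in p, y \in p &
     ((index x p).+1 == index y p) || ((index y p).+1 == index x p)]].

Lemma path_adj_sym : symmetric path_adj.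
Proof. by move=> x y; rewrite /path_adj /= andbCA orbC. Qed.

Lemma path_adj_irr : irreflexive path_adj.
Proof. by move=> x; rewrite /path_adj /= orbb gtn_eqF // !andbF. Qed.

Lemma path_adj_vset x y :
  path_adj x y -> (x \in [set z in p]) && (y \in [set z in p]).
Proof. by move=> /and3P[xp yp _]; rewrite !inE xp. Qed.

Definition path_graph : sgraph T :=
  SGraph path_adj_sym path_adj_irr path_adj_vset.

End Path.

(* A matrix indexed by a set [S : {set T}] is a matrix in ['M_#|S|], whose rows
   and columns are numbered by [enum_val]. *)
Section IndexedMatrices.
Variable R : pzRingType.

Definition mx_on (S : {set T}) (f : T -> T -> R) : 'M[R]_#|S| :=
  \matrix_(i, j) f (enum_val i) (enum_val j).

(* The entry of [M] at [(x, y)], extended by zero: each sum has exactly one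
   term when its index belongs to [S], and none otherwise. *)
Definition entry (S : {set T}) (M : 'M[R]_#|S|) (x y : T) : R :=
  \sum_(i | enum_val i == x) \sum_(j | enum_val j == y) M i j.

Definition glue_mx (S1 S2 : {set T}) (M1 : 'M[R]_#|S1|) (M2 : 'M[R]_#|S2|) :
    'M[R]_#|S1 :|: S2| :=
  mx_on (S1 :|: S2) (fun x y => entry M1 x y + entry M2 x y).

Definition potential (S A : {set T}) : 'M[R]_#|S| :=
  mx_on S (fun x y => ((x == y) && (x \in A))%:R).

Definition adjmx (G : sgraph T) : 'M[R]_#|vset G| :=
  mx_on (vset G) (fun x y => (adj G x y)%:R).

End IndexedMatrices.

Definition cospectral (R : comNzRingType) (G : sgraph T) (u v : T) : Prop :=
  char_poly (adjmx R (del_vertex G u)) = char_poly (adjmx R (del_vertex G v)).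

End Graphs.

Definition expmx (K : numFieldType) (n : nat) (A : 'M[K]_n) : 'M[K]_n :=
  \matrix_(i, j) limn (fun m : nat =>
    (\sum_(0 <= k < m) (k`!%:R)^-1 *: A ^+ k) i j).

Section PGST.
Local Open Scope complex_scope.

Definition PGST (R : realType) (T : finType) (S : {set T}) (N : 'M[R]_#|S|)
    (u v : T) : Prop :=
  limf_esup (fun t : R =>
      (ComplexField.Normc.normc (entry (expmx ((0 +i* t) *:
         map_mx (real_complex R) N)) u v))%:E)
    +oo%R
  = 1%:E.

End PGST.

Definition transcendental (R : realType) (x : R) : Prop :=
  ~ algebraicOver (ratr : rat -> R) x.

Definition alg_indep2 (R : realType) (x y : R) : Prop :=
  forall P : {poly {poly rat}},
    (map_poly (map_poly (ratr : rat -> R)) P).[x, y] = 0 -> P = 0.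

(* Main.v *)
Require Import Defs.
From HB Require Import structures.
From mathcomp Require Import all_boot all_order all_algebra all_real_closed.
From mathcomp Require Import all_classical all_reals all_analysis.
From mathcomp Require Import perm ring lra zify.

Set Implicit Arguments.
Unset Strict Implicit.
Unset Printing Implicit Defensive.

Import Order.TTheory GRing.Theory Num.Theory.
Import numFieldNormedType.Exports.
Local Open Scope ring_scope.

(* Write [C = R[i]].  The Schur complement of [z - N] on [{u, v}] is diagonal in
   the basis [e_u + e_v], [e_u - e_v], because [u] and [v] are cospectral in [G]
   and the path is symmetric; its two diagonal entries have the form
   [a / b - Q] with coprime [a], [b] over [K0 = rat(Q')], [size b < size a].  An
   eigenvector of [N] that does not vanish at [u] is, up to sign, symmetric or
   antisymmetric on [{u, v}] and its eigenvalue is a root of the corresponding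
   polynomial [a - Q b], which is irreducible over [K0(Q)] since it is linear in
   [Q].  Hence, taking traces over [K0(Q)], an integer relation between
   eigenvalues whose coefficients sum to zero becomes a relation between the
   two mean roots.  These differ: [Q'] contributes to the trace of the symmetric
   polynomial only.  So the coefficients on the antisymmetric eigenvalues sum
   to zero.

   The entry [exp(itN)(u, v)] is [U t = \sum_j c_j (-1)^s_j exp(it lam_j)] with
   [c_j >= 0] and [\sum_j c_j = 1].  By the statement on relations, no two words
   of length [n] with the same frequency have opposite signs in the expansion of
   [U t ^+ n], so the coefficients of [U t ^+ n] have total mass 1 and one of
   them is at least [(n + 1)^-#|J|].  A coefficient is bounded by the supremum of
   [|U|^n] over a half-line, so this supremum cannot be below 1. *)

(** * Fields of fractions *)

Section FractionLift.
Variable A : idomainType.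
Local Notation "a %:F" := (FracField.tofrac (R := A) a).

Definition numf (x : {fraction A}) := (frac (repr x)).1.
Definition denf (x : {fraction A}) := (frac (repr x)).2.

Lemma denf_neq0 x : denf x != 0. Proof. exact: denom_ratioP. Qed.

Lemma fraction_reprE (x : {fraction A}) :
  x * (denf x)%:F = (numf x)%:F.
Proof.
rewrite /denf /numf.
rewrite -{1}[x]reprK; unlock FracField.tofrac.
rewrite -[LHS]FracField.pi_mul; apply/eqmodP => /=.
rewrite FracField.equivfE /FracField.mulf !numden_Ratio ?oner_eq0 ?mulr1 //;
  try exact: denom_ratioP.
by rewrite mulrC.
Qed.

Variables (C : fieldType) (f : {rmorphism A -> C}).
Hypothesis f_inj : injective f.

(** Universal property of the field of fractions: as [f] is injective, denominators stay non-zero.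
    The value is read off a chosen representative, and [frac_liftE] shows that any other
    presentation gives the same one. *)
Definition frac_lift (x : {fraction A}) : C :=
  f (numf x) / f (denf x).

Let f_neq0 a : a != 0 -> f a != 0.
Proof. by rewrite -(inj_eq f_inj) rmorph0. Qed.

Let d_neq0 x : f (denf x) != 0.
Proof. exact/f_neq0/denf_neq0. Qed.

Lemma frac_liftE x n d : d != 0 -> x * d%:F = n%:F -> frac_lift x = f n / f d.
Proof.
move=> d0 xd; apply/eqP; rewrite eqr_div ?f_neq0 ?denf_neq0 //.
rewrite -!rmorphM; apply/eqP; congr (f _); apply/eqP.
by rewrite -tofrac_eq !rmorphM /= -xd -fraction_reprE mulrAC [_ * _%:F * _]mulrAC.
Qed.

Lemma frac_lift_is_zmod_morphism : zmod_morphism frac_lift.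
Proof.
move=> x y.
rewrite (@frac_liftE _ ((numf x) * (denf y) -
   (numf y) * (denf x)) ((denf x) * (denf y))).
- rewrite /frac_lift !(rmorphM, rmorphB) /= mulrBl -mulf_div divff ?d_neq0 //.
  by rewrite mulr1 [f (denf x) * _]mulrC -mulf_div divff ?d_neq0 // mulr1.
- by rewrite mulf_neq0 ?denf_neq0.
- rewrite !(rmorphM, rmorphB) /= -!fraction_reprE; ring.
Qed.

Lemma frac_lift_is_monoid_morphism : monoid_morphism frac_lift.
Proof.
split=> [|x y].
  by rewrite (@frac_liftE _ 1 1) ?oner_eq0 ?rmorph1 ?mulr1 // divr1.
rewrite (@frac_liftE _ ((numf x) * (numf y))
   ((denf x) * (denf y))).
- by rewrite /frac_lift !rmorphM /= mulf_div.
- by rewrite mulf_neq0 ?denf_neq0.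
- by rewrite !rmorphM /= -!fraction_reprE mulrACA.
Qed.

HB.instance Definition _ := GRing.isZmodMorphism.Build _ _ frac_lift
  frac_lift_is_zmod_morphism.
HB.instance Definition _ := GRing.isMonoidMorphism.Build _ _ frac_lift
  frac_lift_is_monoid_morphism.

Lemma fraction_lift_exists :
  {g : {rmorphism {fraction A} -> C} | forall a, g a%:F = f a}.
Proof.
exists frac_lift => a; rewrite /= (@frac_liftE _ a 1) ?oner_eq0 //.
  by rewrite rmorph1 divr1.
by rewrite rmorph1 mulr1.
Qed.

(** Turns an equation over a fraction field into a polynomial equation in two variables; each
    coefficient contributes its denominator in turn. *)
Lemma clear_denominators (p : {poly {fraction A}}) :
  exists2 c, c != 0 & exists h : {poly A},
    c%:F *: p = map_poly (FracField.tofrac (R := A)) h.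
Proof.
elim/poly_ind: p => [|p x [c c0 [h hE]]].
  by exists 1; rewrite ?oner_eq0 //; exists 0; rewrite scaler0 rmorph0.
exists (c * (denf x)); first by rewrite mulf_neq0 ?denf_neq0.
exists ((denf x) *: h * 'X + (c * (numf x))%:P).
rewrite [RHS]rmorphD [X in _ = X + _]rmorphM /= map_polyX map_polyC map_polyZ /= -hE.
rewrite scalerDr -!mul_polyC !rmorphM /= -fraction_reprE !rmorphM /=; ring.
Qed.
End FractionLift.

(** * Traces and integer relations between algebraic elements *)

(* For monic [p], minus the sum of the roots. *)
Definition subleading (R : nzRingType) (p : {poly R}) : R :=
  p`_(size p).-2 *+ (1 < size p)%N.

(** Root sums add up over products. The guard in [subleading] gives the polynomial 1 the value 0
    rather than its leading coefficient. *)
Lemma subleadingM (R : nzRingType) (p q : {poly R}) :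
  p \is monic -> q \is monic ->
  subleading (p * q) = subleading p + subleading q.
Proof.
move=> mp mq; rewrite /subleading size_monicM ?monic_neq0 //.
have szp : (0 < size p)%N by rewrite size_poly_gt0 monic_neq0.
have szq : (0 < size q)%N by rewrite size_poly_gt0 monic_neq0.
case sp : (size p) szp => [//|[|a]] _.
  move/eqP: sp => /size_poly1P [c c0 pE]; move: mp; rewrite pE monicE lead_coefC.
  by move=> /eqP ->; rewrite mul1r add0r add1n.
case sq : (size q) szq => [//|[|b]] _.
  move/eqP: sq => /size_poly1P [c c0 qE]; move: mq; rewrite qE monicE lead_coefC.
  by move=> /eqP ->; rewrite mulr1 addr0 addn1.
have pl : p`_a.+1 = 1 by move/monicP: mp; rewrite lead_coefE sp.
have ql : q`_b.+1 = 1 by move/monicP: mq; rewrite lead_coefE sq.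
have -> : (a.+2 + b.+2).-1 = (a + b).+3 by rewrite !addSn !addnS.
rewrite /= !mulr1n coefM.
have la : (a < (a + b).+2)%N by rewrite ltnS leqW // leq_addr.
have la1 : (a.+1 < (a + b).+2)%N by rewrite !ltnS leq_addr.
(* Only the indices [a] and [a.+1] contribute to this coefficient: at any other index one of the two
   factors is beyond its degree. *)
rewrite (bigD1 (Ordinal la)) //= (bigD1 (Ordinal la1)) /=; last first.
  by rewrite -val_eqE /= gtn_eqF.
rewrite big1 => [|i /andP[]]; last first.
  rewrite -!val_eqE /= => ia ia1.
  case: (ltngtP i a) ia => // [ilt _|igt _].
    rewrite [q`_ _]nth_default ?mulr0 // sq; lia.
  rewrite [p`_ _]nth_default ?mul0r // sp.
  by rewrite ltn_neqAle eq_sym ia1.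
rewrite addr0 subSS -addnS !addKn pl mul1r; congr (_ + _).
by rewrite ql mulr1.
Qed.

(** In effect [g] is a power of [P]: an irreducible polynomial that shares a root with [g] divides
    it, and the quotient satisfies the same hypothesis. Both sides are additive in [g]. *)
Lemma subleading_powers (F : fieldType) (C : closedFieldType)
    (iota : {rmorphism F -> C}) (P g : {poly F}) :
  P \is monic -> irreducible_poly P -> g \is monic ->
  (forall y, root (map_poly iota g) y -> root (map_poly iota P) y) ->
  subleading g *+ (size P).-1 = subleading P *+ (size g).-1.
Proof.
move=> mP [P1 Pirr].
have [n] := ubnP (size g); elim: n g => // n IHn g; rewrite ltnS => szg mg rg.
have [sg1|sg1] := eqVneq (size g) 1%N.
  by rewrite sg1 /subleading sg1 mulr0n mul0rn.
have /closed_rootP [y gy] : size (map_poly iota g) != 1 by rewrite size_map_poly.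
have Py := rg _ gy.
have Pg : P %| g.
  have : ~~ coprimep P g.
    apply/negP; rewrite -(coprimep_map iota) => cop.
    by have := Pdiv.Idomain.coprimep_root cop Py; rewrite -/(root _ _) gy.
  rewrite /coprimep => /Pirr /(_ (dvdp_gcdl _ _)) => /eqp_dvdl <-.
  exact: dvdp_gcdr.
have [h gE] := dvdpP _ _ Pg.
have mh : h \is monic by move: mg; rewrite gE monicMr.
have hlt : (size h < n)%N.
  apply: leq_trans _ szg; rewrite gE size_monicM ?monic_neq0 //.
  apply: (_ : forall a b, 0 < a -> 1 < b -> a < (a + b).-1)%N => //; first by lia.
  by rewrite size_poly_gt0 monic_neq0.
have := IHn h hlt mh; rewrite gE subleadingM // mulrnDl => ->; last first.
  by move=> x hx; apply: rg; rewrite gE rmorphM rootM hx.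
rewrite -mulrnDr size_monicM ?monic_neq0 //; congr (_ *+ _).
apply: (_ : forall a b, 0 < a -> 1 < b -> a.-1 + b.-1 = (a + b).-1.-1)%N => //.
  by lia.
by rewrite size_poly_gt0 monic_neq0.
Qed.

Section TraceRelation.
Variables (F : fieldType) (C : closedFieldType) (iota : {rmorphism F -> C}).
Local Notation "M ^i" := (map_mx iota M) (at level 2, format "M ^i").

(** The powers of [z] form a left eigenvector of the companion matrix of any monic polynomial that
    annihilates [z]. *)
Lemma companion_eigenvector (z : C) : algebraicOver iota z ->
  exists n (r : 'rV[C]_n), r != 0 /\ exists M : 'M[F]_n, r *m M^i = z *: r.
Proof.
move=> /integral_algebraic [p mp pz].
have sp : (1 < size p)%N.
  rewrite ltnNge; apply/negP => sp; move: pz.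
  have -> : p = 1.
    move/size1_polyC: sp mp => ->; rewrite monicE lead_coefC => /eqP -> //.
  by rewrite rmorph1 /root hornerC oner_eq0.
pose d := (size p).-2; have dE : size p = d.+2 by rewrite /d; lia.
exists d.+1, (\row_j z ^+ j); split.
  apply/eqP => /rowP /(_ ord0) /eqP; rewrite !mxE expr0 oner_eq0 //.
exists (\matrix_(i, j) if (j == d :> nat) then - p`_i else (i == j.+1 :> nat)%:R).
apply/rowP => j; rewrite !mxE.
have [jd|jd] := eqVneq (j : nat) d.
  under eq_bigr => i _ do rewrite !mxE jd eqxx rmorphN mulrN.
  rewrite sumrN jd -exprS.
  have lp : p`_d.+1 = 1 by move/monicP: mp; rewrite lead_coefE dE.
  have E : \sum_(i < d.+1) iota p`_i * z ^+ i + z ^+ d.+1 = 0.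
    move/rootP: pz => pz0; apply: etrans _ pz0.
    rewrite (@horner_coef_wide _ d.+2); last first.
      by rewrite size_map_poly dE.
    rewrite [RHS]big_ord_recr /=; congr (_ + _).
      by apply: eq_bigr => i _; rewrite coef_map.
    by rewrite coef_map /= lp; rewrite (rmorph1 iota) mul1r.
  move/eqP: E; rewrite addr_eq0 => /eqP E; apply/eqP.
  rewrite eqr_oppLR -E; apply/eqP/eq_bigr => i _.
  by rewrite mulrC.
have jlt : (j.+1 < d.+1)%N by have := ltn_ord j; lia.
rewrite (bigD1 (Ordinal jlt)) //= !mxE (negPf jd) eqxx rmorph1 mulr1 big1.
  by rewrite addr0 exprS.
move=> i; rewrite -val_eqE /= => ij.
by rewrite !mxE (negPf jd) (negPf ij) rmorph0 mulr0.
Qed.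

(** Tensor the companion eigenvectors together: each element of [s] acts on its own factor and
    trivially on the others. The row count [q] is a product of ones, left general because of the
    shape of [tensmx]. *)
Lemma common_eigenvector (s : seq C) : (forall z, z \in s -> algebraicOver iota z) ->
  exists q n (e : 'M[C]_(q, n)), e != 0 /\
    forall z, z \in s -> exists M : 'M[F]_n, e *m M^i = z *: e.
Proof.
elim: s => [|z s IHs] alg.
  by exists 1%N, 1%N, 1%:M; split=> //; exact: oner_neq0.
have [|q [n [e [e0 eM]]]] := IHs.
  by move=> y ys; apply: alg; rewrite inE ys orbT.
have [m [r [r0 [Mz rM]]]] := companion_eigenvector (alg z (mem_head _ _)).
exists (q * 1)%N, (n * m)%N, (tensmx e r); split.
  have /matrix0Pn [i [j eij]] := e0; have /matrix0Pn [k [l rkl]] := r0.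
  apply/matrix0Pn; exists (mxtens_index (i, k)), (mxtens_index (j, l)).
  by rewrite tensmxE mulf_neq0.
move=> y; rewrite inE => /predU1P [->|ys].
  exists (tensmx 1%:M Mz); rewrite map_mxT tensmx_mul map_mx1 mulmx1 rM.
  by apply/matrixP => i j; rewrite !mxE mulrCA.
have [M eMy] := eM y ys.
exists (tensmx M 1%:M); rewrite map_mxT tensmx_mul map_mx1 mulmx1 eMy.
by apply/matrixP => i j; rewrite !mxE mulrA.
Qed.

(* Minimality of [n] makes the entries of [e] free over [F]. *)
Lemma common_eigenvector_free (s : seq C) :
  (forall z, z \in s -> algebraicOver iota z) ->
  exists q n (e : 'M[C]_(q, n)),
   [/\ e != 0, forall c : 'cV[F]_n, e *m c^i = 0 -> c = 0 &
    forall z, z \in s -> exists M : 'M[F]_n, e *m M^i = z *: e].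
Proof.
move=> /common_eigenvector [q [n0 [e0 [e00 eM0]]]].
have [N] := ubnP n0; elim: N n0 e0 e00 eM0 => // N IHN n e e_neq0 eM; rewrite ltnS => nN.
have [free|] := pselect (forall c : 'cV[F]_n, e *m c^i = 0 -> c = 0).
  by exists q, n, e; split.
move=> /existsNP [c /not_implyP [ec0 /eqP c0]].
(* A relation [c] over [F] puts [e] in the row space of a basis [B] of the kernel of [c], of smaller
   dimension. This space need not be stable under [M]: compressing [M] to it suffices, since
   [e *m M] is a multiple of [e]. *)
pose B := row_base (kermx c).
have eB : (e <= B^i)%MS.
  apply: (@submx_trans _ _ _ _ _ _ (kermx c)^i).
    by rewrite map_kermx; apply/sub_kermxP.
  by rewrite map_submx eq_row_base.
pose e' := e *m pinvmx B^i.
have e'E : e' *m B^i = e by rewrite mulmxKpV.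
apply: (IHN _ e').
- by apply: contra_neq e_neq0 => e'0; rewrite -e'E e'0 mul0mx.
- move=> z /eM [M eMz]; exists (B *m M *m pinvmx B).
  have -> : (B *m M *m pinvmx B)^i = B^i *m M^i *m pinvmx B^i.
    by rewrite 2!map_mxM map_pinvmx.
  by rewrite 2!mulmxA e'E eMz -scalemxAl.
- apply: leq_trans _ nN; rewrite mxrank_ker.
  have : (0 < \rank c)%N by rewrite lt0n mxrank_eq0.
  have := rank_leq_row c; lia.
Qed.

Lemma horner_mx_eigen (q n : nat) (e : 'M[C]_(q, n.+1)) (M : 'M[C]_n.+1) z p :
  e *m M = z *: e -> e *m horner_mx M p = p.[z] *: e.
Proof.
move=> eM; elim/poly_ind: p => [|p c IHp].
  by rewrite rmorph0 mulmx0 horner0 scale0r.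
rewrite rmorphD rmorphM /= horner_mx_X horner_mx_C hornerMXaddC mulmxDr.
by rewrite mulmxA IHp -scalemxAl eM scalerA mul_mx_scalar -scalerDl.
Qed.

(* The relation between the [z i] holds between the matrices that act as
   [z i] on a free common eigenvector, where one can take traces: this replaces
   averaging over a Galois group. *)
Theorem trace_relation (I : finType) (z : I -> C) (P : I -> {poly F})
    (l : I -> int) :
  [pchar F] =i pred0 ->
  (forall i, l i != 0 -> [/\ P i \is monic, irreducible_poly (P i) &
     root (map_poly iota (P i)) (z i)]) ->
  \sum_i z i *~ l i = 0 ->
  \sum_i (subleading (P i) / (size (P i)).-1%:R) *~ l i = 0.
Proof.
move=> char0 HP sum0.
pose s := [seq z i | i <- enum I & l i != 0].
have [|q [n [e [e0 free eM]]]] := @common_eigenvector_free s.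
  move=> _ /mapP [i + ->]; rewrite mem_filter => /andP [/HP [mP _ Pz] _].
  by exists (P i) => //; rewrite monic_neq0.
case: n e e0 free eM => [|n] e e0 free eM.
  by case/eqP: e0; apply/matrixP => i [].
have freeM (K : 'M[F]_n.+1) : e *m K^i = 0 -> K = 0.
  move=> eK; apply/matrixP => i j; have : col j K = 0.
    apply: free; apply/colP => k; move/matrixP/(_ k j): eK; rewrite !mxE; apply: etrans.
    by apply: eq_bigr => m _; rewrite !mxE.
  by move=> /colP /(_ i); rewrite !mxE.
have : forall i, exists M : 'M[F]_n.+1, l i != 0 -> e *m M^i = z i *: e.
  move=> i; have [li|li] := eqVneq (l i) 0; first by exists 0 => /eqP.
  have [|M eMi] := eM (z i); last by exists M.
  by apply/mapP; exists i => //; rewrite mem_filter li mem_enum.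
move=> /fin_all_exists [M eMi].
(* The same combination of the matrices acts on [e] as the vanishing combination of the [z i], and
   freeness makes the action faithful. *)
have KE : \sum_i M i *~ l i = 0.
  apply: freeM; rewrite map_mx_sum mulmx_sumr.
  under eq_bigr => i _.
    have -> : e *m (M i *~ l i)^i = (z i *~ l i) *: e.
      have [->|li] := eqVneq (l i) 0; first by rewrite !mulr0z map_mx0 mulmx0 scale0r.
      by rewrite raddfMz /= (raddfMz (mulmx e)) /= eMi // scalerMzl.
    over.
  by rewrite -scaler_suml sum0 scale0r.
(* The irreducible [P i] annihilates [M i], so the characteristic polynomial of [M i] has only roots
   of [P i], and the mean root of [P i] is the normalized trace of [M i]. *)
have trE i : l i != 0 ->
    subleading (P i) / (size (P i)).-1%:R = - (n.+1%:R)^-1 * \tr (M i).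
  move=> li; have [mP irrP Pz] := HP _ li.
  have PM : horner_mx (M i) (P i) = 0.
    apply: freeM; rewrite map_horner_mx (horner_mx_eigen _ (eMi _ li)).
    by move/rootP: Pz => ->; rewrite scale0r.
  have := @subleading_powers _ _ iota (P i) (char_poly (M i)) mP irrP
    (char_poly_monic _).
  rewrite {1}/subleading size_char_poly /= char_poly_trace // mulr1n => E.
  have nz k : (0 < k)%N -> k%:R != 0 :> F.
    by case: k => // k _; rewrite -[k.+1]/(0 + k.+1)%N; move/pcharf0P: char0 => ->.
  have dn0 : (size (P i)).-1%:R != 0 :> F by apply: nz; case: irrP; case: size => [|[]].
  have nn0 : n.+1%:R != 0 :> F by apply: nz.
  have {}E : - \tr (M i) *+ (size (P i)).-1 = subleading (P i) *+ n.+1.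
    apply: E => y; rewrite map_char_poly -root_mxminpoly mxminpoly_map => yM.
    have /dvdpP [r ->] : mxminpoly (M i) %| P i by rewrite dvd_mxminpoly PM.
    by rewrite rmorphM rootM yM orbT.
  apply: (mulIf dn0); rewrite divfK //; apply: (mulIf nn0).
  by rewrite mulr_natr -E -mulr_natr; field; rewrite -mulrS.
under eq_bigr => i _.
  have -> : (subleading (P i) / (size (P i)).-1%:R) *~ l i =
      - (n.+1%:R)^-1 * \tr (M i *~ l i).
    have [->|li] := eqVneq (l i) 0; first by rewrite !mulr0z mxtrace0 mulr0.
    by rewrite trE // (raddfMz mxtrace) mulrzAr.
  over.
have := congr1 mxtrace KE; rewrite mxtrace0 raddf_sum /= => trK.
by rewrite -mulr_sumr trK mulr0.
Qed.
End TraceRelation.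

(** * Irreducibility of polynomials linear in a transcendental parameter *)

Lemma algebraicOver_horner (F E : fieldType) (f : {rmorphism F -> E})
    (p : {poly F}) (z : E) :
  algebraicOver f z -> algebraicOver f (map_poly f p).[z].
Proof.
move=> zalg; elim/poly_ind: p => [|p c IHp].
  by rewrite rmorph0 horner0; exact: algebraic0.
rewrite rmorphD rmorphM /= map_polyX map_polyC hornerMXaddC.
exact/algebraic_add/algebraic_id/algebraic_mul.
Qed.

(** Modulo [a] only the term in [g 0] survives; since [b] is prime to [a], [a] divides [g 0], which
    is too small unless it vanishes. Divide the form by [a] and repeat. *)
Lemma coprimep_form_eq0 (K : fieldType) (a b : {poly K}) (g : nat -> {poly K})
    (s : nat) :
  coprimep a b -> (forall i, (size (g i) < size a)%N) ->
  \sum_(i < s.+1) g i * a ^+ i * b ^+ (s - i) = 0 ->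
  forall i, (i <= s)%N -> g i = 0.
Proof.
move=> cop; elim: s g => [|s IHs] g gsz gsum.
  by case=> // _; move: gsum; rewrite big_ord1 expr0 !mulr1.
have a0 : a != 0 by rewrite -size_poly_gt0 (leq_ltn_trans _ (gsz 0)).
have sumE : g 0 * b ^+ s.+1 =
    - (a * \sum_(i < s.+1) g i.+1 * a ^+ i * b ^+ (s - i)).
  apply/eqP; rewrite -addr_eq0 -[X in _ == X]gsum; apply/eqP.
  rewrite [RHS]big_ord_recl expr0 mulr1 subn0; congr (_ + _).
  rewrite mulr_sumr; apply: eq_bigr => i _.
  rewrite lift0 subSS exprS; ring.
have g00 : g 0 = 0.
  apply/eqP; apply: contraTT (gsz 0) => g0; rewrite -leqNgt.
  apply: dvdp_leq => //.
  rewrite -(@Gauss_dvdpl _ _ (b ^+ s.+1)) ?coprimep_expr //.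
  by rewrite sumE dvdpNr dvdp_mulr.
case=> // i; rewrite ltnS; apply: (IHs (fun i => g i.+1)) => //.
apply/(mulfI a0); rewrite mulr0; apply/eqP.
by rewrite -oppr_eq0 -sumE g00 mul0r.
Qed.

Section LinearParameter.
Variables (K : fieldType) (C : closedFieldType) (j : {rmorphism K -> C}) (x : C).
Hypothesis x_trans : ~ algebraicOver j x.
Local Notation F := {fraction {poly K}}.
Local Notation "p %:F" := (FracField.tofrac p).
Variable iota : {rmorphism F -> C}.
Hypothesis iotaE : forall p : {poly K}, iota p%:F = (map_poly j p).[x].

Definition constF (c : K) : F := (c%:P)%:F.
Lemma constF_is_zmod_morphism : zmod_morphism constF.
Proof. by move=> a b; rewrite /constF !rmorphB. Qed.
Lemma constF_is_monoid_morphism : monoid_morphism constF.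
Proof. by split=> [|a b]; rewrite /constF ?rmorph1 // !rmorphM. Qed.
HB.instance Definition _ := GRing.isZmodMorphism.Build _ _ constF
  constF_is_zmod_morphism.
HB.instance Definition _ := GRing.isMonoidMorphism.Build _ _ constF
  constF_is_monoid_morphism.

Variables a b : {poly K}.
Hypotheses (cop_ab : coprimep a b) (b_lt_a : (size b < size a)%N)
  (a_gt1 : (1 < size a)%N).

(** The indeterminate of the fraction field stands for the potential, which [iota] specializes to
    the number [x]. *)
Definition pencil : {poly F} :=
  map_poly constF a - ('X)%:F *: map_poly constF b.

Lemma map_pencil :
  map_poly iota pencil = map_poly j a - x *: map_poly j b.
Proof.
have jE : iota \o constF =1 j.
  by move=> c; rewrite /= iotaE map_polyC hornerC.
rewrite rmorphB /= linearZ /= iotaE map_polyX hornerX -!map_poly_comp.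
by congr (_ - _ *: _); apply: eq_map_poly.
Qed.

Lemma size_pencil : size pencil = size a.
Proof.
rewrite size_polyDl ?size_map_poly // size_polyN.
by rewrite (leq_ltn_trans (size_scale_leq _ _)) ?size_map_poly.
Qed.

Lemma pencil_monic : a \is monic -> pencil \is monic.
Proof.
move=> ma; rewrite monicE /pencil lead_coefDl ?lead_coef_map ?(monicP ma) ?rmorph1 //.
by rewrite size_polyN (leq_ltn_trans (size_scale_leq _ _)) ?size_map_poly.
Qed.

(** The leading coefficient of [b] falls exactly on the subleading place, so the parameter enters
    the trace with coefficient -1 in every such pencil. *)
Lemma subleading_pencil : b \is monic -> size a = (size b).+1 ->
  subleading pencil = constF (subleading a) - ('X)%:F.
Proof.
move=> mb sab; have b0 : (0 < size b)%N by rewrite size_poly_gt0 monic_neq0.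
rewrite /subleading size_pencil a_gt1 !mulr1n /pencil coefB coefZ !coef_map /=.
have -> : b`_(size a).-2 = 1 by rewrite sab -[RHS](monicP mb) lead_coefE.
by rewrite rmorph1 mulr1.
Qed.

Lemma pencil_root_ratio (z : C) :
  root (map_poly iota pencil) z ->
  (map_poly j b).[z] != 0 /\ (map_poly j a).[z] = x * (map_poly j b).[z].
Proof.
rewrite map_pencil /root !hornerE subr_eq0 => /eqP azE; split=> //.
apply/negP => bz; have := cop_ab; rewrite -(coprimep_map j) => cop.
have az : root (map_poly j a) z by rewrite /root azE (eqP bz) mulr0.
by have := Pdiv.Idomain.coprimep_root cop az; rewrite bz.
Qed.

(** Since [x] is a rational function of [z] over [K], it would be algebraic if [z] were. *)
Lemma pencil_root_trans (z : C) :
  root (map_poly iota pencil) z -> ~ algebraicOver j z.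
Proof.
move=> /pencil_root_ratio [bz azE] zalg; apply: x_trans.
have -> : x = (map_poly j a).[z] / (map_poly j b).[z] by rewrite azE mulfK.
by apply: algebraic_div; apply: algebraicOver_horner.
Qed.

(* As [x = a.[z] / b.[z]], an equation of [z] over [K(x)] yields a form in [a]
   and [b] that vanishes at [z], hence identically, [z] being transcendental. *)
Lemma pencil_root_degree (z : C) (h : {poly F}) :
  root (map_poly iota pencil) z -> root (map_poly iota h) z ->
  h != 0 -> (size a <= size h)%N.
Proof.
move=> Pz hz h0; rewrite leqNgt; apply/negP => hlt; case/negP: h0.
have [bz azE] := pencil_root_ratio Pz.
have [c c0 [H HE]] := clear_denominators h.
have inj : injective (FracField.tofrac (R := {poly K})).
  by move=> u v /eqP; rewrite tofrac_eq => /eqP.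
have szH : size H = size h.
  by rewrite -(size_scale h (_ : c%:F != 0)) ?tofrac_eq0 // HE size_map_inj_poly.
have evalE (q : {poly {poly K}}) :
    (map_poly iota (map_poly (FracField.tofrac (R := {poly K})) q)).[z] =
    (map_poly (map_poly j) q).[z, x].
  rewrite -map_poly_comp (horner_coef_wide _ (size_poly _ _)).
  rewrite (horner_coef_wide _ (size_poly _ _)) horner_sum.
  by apply: eq_bigr => i _; rewrite -polyC_exp hornerM hornerC !coef_map /= iotaE.
have : (map_poly (map_poly j) H).[z, x] = 0.
  rewrite -evalE -HE linearZ /= hornerZ.
  by move: hz; rewrite /root => /eqP ->; rewrite mulr0.
rewrite -horner2_swapXY swapXY_map.
(* [G] is [H] regarded as a polynomial in the parameter; its coefficients are polynomials in the
   root variable, smaller than [a]. *)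
set G := swapXY H => Gzx.
have szG i : (size (G`_i)%R < size a)%N.
  apply: leq_ltn_trans hlt; rewrite -szH; apply/leq_sizeP => k Hk.
  by rewrite coef_swapXY (nth_default _ Hk) ?coef0.
have G0 : G = 0.
  case: (posnP (size G)) => [/eqP|szG_gt0].
    by rewrite size_poly_eq0 => /eqP.
  pose s := (size G).-1.
  (* Multiplying the equation by the power [s] of [b] at [z] replaces [x ^+ i] by powers of [a] and
     [b]. A non-zero form over [K] would then make [z] algebraic. *)
  have form0 : \sum_(i < s.+1) G`_i * a ^+ i * b ^+ (s - i) = 0.
    apply/eqP; apply/negPn/negP => f0; apply: (pencil_root_trans Pz).
    exists (\sum_(i < s.+1) G`_i * a ^+ i * b ^+ (s - i)) => //.
    have sumG : \sum_(i < s.+1) (map_poly j G`_i).[z] * x ^+ i = 0.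
      rewrite -[RHS]Gzx (@horner_coef_wide _ s.+1 (map_poly (map_poly j) G)); last first.
        by apply: leq_trans (size_poly _ _) _; rewrite prednK.
      rewrite horner_sum; apply: eq_bigr => i _.
      by rewrite -polyC_exp hornerM hornerC coef_map.
    rewrite rmorph_sum /root horner_sum /=; apply/eqP.
    rewrite -[RHS](mul0r ((map_poly j b).[z] ^+ s)) -[in RHS]sumG mulr_suml.
    apply: eq_bigr => i _; rewrite !(rmorphM, rmorphXn) /= !hornerE azE.
    have bs : (map_poly j b).[z] ^+ s =
        (map_poly j b).[z] ^+ i * (map_poly j b).[z] ^+ (s - i).
      by rewrite -exprD subnKC // -ltnS.
    by rewrite bs exprMn !mulrA.
  apply/polyP => i; rewrite coef0.
  case: (leqP i s) => [ile|]; last by rewrite prednK // => /(nth_default 0).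
  exact: (coprimep_form_eq0 cop_ab _ form0).
have : H == 0 by rewrite -swapXY_eq0 -/G G0.
move/eqP=> H0; move/eqP: HE; rewrite H0 rmorph0 scaler_eq0 tofrac_eq0 (negPf c0).
by [].
Qed.

(** A non-constant divisor has a root, which is a root of the pencil, and [pencil_root_degree] then
    forces the divisor to have full degree. *)
Theorem pencil_irreducible : irreducible_poly pencil.
Proof.
split=> [|q q1 qP]; first by rewrite size_pencil.
have P0 : pencil != 0 by rewrite -size_poly_gt0 size_pencil ltnW.
have q0 : q != 0 by apply: contraNneq P0 => q0; move: qP; rewrite q0 dvd0p.
have /closed_rootP [z qz] : size (map_poly iota q) != 1 by rewrite size_map_poly.
rewrite -dvdp_size_eqp // eqn_leq dvdp_leq //= size_pencil.
apply: (@pencil_root_degree z) => //.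
by case/dvdpP: qP => r ->; rewrite rmorphM rootM qz orbT.
Qed.
End LinearParameter.

(** * Trigonometric polynomials on a half-line *)

Section AlmostPeriodic.
Variable R : realType.
Local Notation normc := (@ComplexField.Normc.normc R).
Local Notation "x %:C" := (real_complex R x).

Definition expi (x : R) : R[i] := Complex (cos x) (sin x).

Lemma expi0 : expi 0 = 1.
Proof. by rewrite /expi cos0 sin0. Qed.

Lemma expiD x y : expi (x + y) = expi x * expi y.
Proof. by rewrite /expi cosD sinD; apply/eqP; rewrite eq_complex /= eqxx addrC eqxx. Qed.

Lemma expi_sum (I : Type) (r : seq I) (F : I -> R) :
  expi (\sum_(i <- r) F i) = \prod_(i <- r) expi (F i).
Proof. exact: (big_morph expi expiD expi0). Qed.

Lemma normc_expi x : normc (expi x) = 1.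
Proof. by rewrite /ComplexField.Normc.normc /= cos2Dsin2 sqrtr1. Qed.

Lemma expi_pi : expi pi = -1.
Proof. by rewrite /expi cospi sinpi; apply/eqP; rewrite eq_complex /= oppr0 !eqxx. Qed.

Lemma expiNpi : expi (- pi) = -1.
Proof. by rewrite /expi cosN sinN cospi sinpi; apply/eqP; rewrite eq_complex /= oppr0 !eqxx. Qed.

Lemma normc_real (x : R) : normc x%:C = `|x|.
Proof. by rewrite /ComplexField.Normc.normc /= expr0n addr0 sqrtr_sqr. Qed.

Lemma normcM (y z : R[i]) : normc (y * z) = normc y * normc z.
Proof. exact: ComplexField.Normc.normcM. Qed.

Lemma normcD (y z : R[i]) : normc (y + z) <= normc y + normc z.
Proof. exact: le_normcD. Qed.

Lemma normcX z n : normc (z ^+ n) = normc z ^+ n.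
Proof.
elim: n => [|n IHn]; first by rewrite !expr0 ComplexField.Normc.normc1.
by rewrite !exprS normcM IHn.
Qed.

Lemma normc_ge0 z : 0 <= normc z.
Proof. by case: z => a b; exact: sqrtr_ge0. Qed.

(* Averaging [h] with its translate by [pi / nu] kills the frequency [nu]
   and keeps both the constant term and the bound. *)
Lemma constant_term_bound (I : eqType) (r : seq I) (A : I -> R[i]) (nu : I -> R)
    (A0 : R[i]) (B t0 : R) :
  (forall i, i \in r -> nu i != 0) ->
  (forall t, t0 <= t -> normc (A0 + \sum_(i <- r) A i * expi (t * nu i)) <= B) ->
  normc A0 <= B.
Proof.
elim: r A => [|i r IHr] A nu0 hB.
  by have := hB t0 (lexx _); rewrite big_nil addr0.
(* The absolute value makes the translation non-negative, so that it preserves the half-line. The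
   resulting phase is [pi] or [- pi], and both give -1. *)
pose tau := pi / `|nu i|.
have ni0 : nu i != 0 by apply: nu0; rewrite mem_head.
have tau0 : 0 <= tau by rewrite divr_ge0 ?pi_ge0.
have killed : expi (tau * nu i) = -1.
  rewrite /tau; case: (ltrgt0P (nu i)) ni0 => [p _|p _|-> /eqP //].
    by rewrite divfK ?gt_eqF // expi_pi.
  by rewrite invrN mulrN mulNr divfK ?lt_eqF // expiNpi.
apply: (IHr (fun k => A k * ((1 + expi (tau * nu k)) / 2))) => [k kr|t t0t].
  by apply: nu0; rewrite inE kr orbT.
have h1 := hB t t0t; have h2 := hB (t + tau) (le_trans t0t (ler_wpDr tau0 (lexx _))).
have -> : A0 + \sum_(k <- r) A k * ((1 + expi (tau * nu k)) / 2) * expi (t * nu k) =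
   2^-1%:C * ((A0 + \sum_(k <- i :: r) A k * expi (t * nu k)) +
           (A0 + \sum_(k <- i :: r) A k * expi ((t + tau) * nu k))).
  rewrite !big_cons (mulrDl t tau) expiD killed mulrN1 mulrN.
  have -> : 2^-1%:C = 2^-1 by rewrite fmorphV rmorph_nat.
  have two : (2 : R[i]) != 0 by rewrite pnatr_eq0.
  set S1 := \sum_(k <- r) A k * expi (t * nu k).
  set S2 := \sum_(k <- r) A k * expi ((t + tau) * nu k).
  have -> : \sum_(k <- r) A k * ((1 + expi (tau * nu k)) / 2) * expi (t * nu k) =
      2^-1 * (S1 + S2).
    rewrite /S1 /S2 -big_split mulr_sumr; apply: eq_bigr => k _ /=.
    by rewrite (mulrDl t tau) expiD; ring.
  by field.
rewrite normcM normc_real ger0_norm ?invr_ge0 //.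
apply: (@le_trans _ _ (2^-1 * (B + B))).
  rewrite ler_wpM2l ?invr_ge0 //.
  exact: le_trans (normcD _ _) (lerD h1 h2).
by lra.
Qed.

(** Geometric decay beats polynomial growth; the argument uses only Bernoulli's inequality. *)
Lemma poly_geometric_lt1 (J : nat) (rho : R) : 0 <= rho ->
  (forall n, 1 <= n.+1%:R ^+ J * rho ^+ n) -> 1 <= rho.
Proof.
move=> rho0 H; rewrite leNgt; apply/negP => rho1.
have [rhoz|rhop] := eqVneq rho 0.
  by have := H 1%N; rewrite rhoz expr1 mulr0 ler10.
pose h := rho^-1 - 1.
have h0 : 0 < h by rewrite subr_gt0 invf_gt1 // lt_def rhop.
have bern m : 1 + m%:R * h <= rho^-1 ^+ m.
  elim: m => [|m IHm]; first by rewrite mul0r addr0.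
  have ih : 0 <= 1 + m%:R * h by rewrite addr_ge0 // mulr_ge0 // ltW.
  rewrite exprS; apply: le_trans (ler_pM _ ih (lexx _) IHm); last first.
    by rewrite invr_ge0.
  have -> : rho^-1 = 1 + h by rewrite /h; ring.
  have -> : (1 + h) * (1 + m%:R * h) = 1 + m.+1%:R * h + m%:R * h ^+ 2.
    by rewrite -addn1 natrD; ring.
  by rewrite lerDl mulr_ge0 // sqr_ge0.
have rn n : rho^-1 ^+ n <= n.+1%:R ^+ J.
  rewrite exprVn -[leLHS]mul1r ler_pdivrMr ?H //.
  by rewrite exprn_gt0 // lt_def rhop.
(* At the exponent [k * m], Bernoulli's bound to the power [J.+1] faces a polynomial of degree [J]
   in [m]. The constant [h'] compares the two linear factors ([lin]), so that [J] of the powers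
   cancel and [bound] stays linear in [m]. *)
pose k := J.+1.
pose h' := Num.min 1 (h / k%:R).
have k0 : 0 < k%:R :> R by rewrite ltr0n.
have h'0 : 0 < h' by rewrite lt_min ltr01 divr_gt0.
have lin m : h' * (k * m).+1%:R <= 1 + m%:R * h.
  have -> : h' * (k * m).+1%:R = h' + h' * k%:R * m%:R.
    by rewrite -addn1 natrD natrM; ring.
  rewrite lerD ?ge_min ?lexx // mulrC ler_wpM2l // -ler_pdivlMr //.
  by rewrite ge_min lexx orbT.
have bound m : (1 + m%:R * h) * h' ^+ J <= 1.
  have mk0 : 0 < (k * m).+1%:R ^+ J :> R by rewrite exprn_gt0 // ltr0n.
  rewrite -(ler_pM2r mk0) mul1r -mulrA -exprMn.
  apply: le_trans (rn (k * m)%N); rewrite mulnC exprM.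
  apply: (@le_trans _ _ ((1 + m%:R * h) ^+ k)); last first.
    by rewrite lerXn2r ?nnegrE ?bern ?exprn_ge0 ?invr_ge0 // addr_ge0 // mulr_ge0 // ltW.
  rewrite exprS ler_wpM2l ?addr_ge0 ?mulr_ge0 ?(ltW h0) //.
  by rewrite lerXn2r ?nnegrE ?addr_ge0 ?mulr_ge0 ?(ltW h0) ?(ltW h'0) // mulnC lin.
have hJ : 0 < h' ^+ J by rewrite exprn_gt0.
(* Large enough for [m%:R * h * h' ^+ J] to exceed 1, against [bound]. *)
pose m := (Num.truncn (h^-1 * (h' ^+ J)^-1)).+1.
have := bound m; rewrite leNgt => /negP; apply.
rewrite -ltr_pdivrMr // mul1r; apply: (@lt_le_trans _ _ (m%:R * h)); last by rewrite lerDr.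
by rewrite -ltr_pdivrMr // mulrC truncnS_gt.
Qed.

Section Words.
Variables (I : finType) (lam c : I -> R) (s : I -> bool).
Hypotheses (c_ge0 : forall i, 0 <= c i) (c_sum : \sum_i c i = 1).
Hypothesis relation : forall l : I -> int,
  (forall i, l i != 0 -> c i != 0) ->
  \sum_i l i = 0 -> \sum_i lam i *~ l i = 0 -> \sum_i l i *+ s i = 0.

Variable n : nat.
Implicit Type f : {ffun 'I_n -> I}.
(** The word [f] contributes one term to the expansion of [U t ^+ n] (see [powerE]); these are its
    modulus, its frequency and the exponent of its sign. *)
Let weight f : R := \prod_k c (f k).
Let freq f : R := \sum_k lam (f k).
Let parity f : nat := \sum_k s (f k).
Let letters f (i : I) : nat := #|[pred k | f k == i]|.

Let sum_letters (V : zmodType) (F : I -> V) f :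
  \sum_k F (f k) = \sum_i F i *+ letters f i.
Proof.
rewrite (partition_big f predT) //=; apply: eq_bigr => i _.
rewrite -sumr_const; apply: eq_big => [k|k /eqP -> //].
by rewrite inE.
Qed.

Let letters_gt0 f i : weight f != 0 -> (0 < letters f i)%N -> c i != 0.
Proof.
move=> wf /card_gt0P [k]; rewrite inE => /eqP <-.
by apply: contra_neq wf => ck; rewrite /weight (bigD1 k) //= ck mul0r.
Qed.

(** The difference of the letter counts is an integer relation between the [lam i], with
    coefficients summing to zero because both words have length [n]. So [relation] says that both
    words use equally many letters of negative sign. *)
Let parity_eq f f0 : weight f != 0 -> weight f0 != 0 -> freq f = freq f0 ->
  parity f = parity f0.
Proof.
move=> wf wf0 fq.
pose l i : int := (letters f i)%:Z - (letters f0 i)%:Z.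
have sum_l (V : zmodType) (F : I -> V) :
    \sum_i F i *~ l i = \sum_k F (f k) - \sum_k F (f0 k).
  by rewrite !sum_letters -sumrB; apply: eq_bigr => i _; rewrite /l mulrzBr.
have := relation (l := l).
have -> : \sum_i l i = 0.
  have := sum_l int (fun=> 1); rewrite !sumr_const subrr => E.
  by rewrite -[RHS]E; apply: eq_bigr => i _; rewrite intz.
rewrite sum_l -/(freq f) -/(freq f0) fq subrr => /(_ _ erefl erefl) H.
have {}H : \sum_i l i *+ s i = 0.
  apply: H => i li; case: (posnP (letters f i)) => [f0i|]; last exact: letters_gt0.
  case: (posnP (letters f0 i)) => [f00i|]; last exact: letters_gt0.
  by move: li; rewrite /l f0i f00i subrr eqxx.
have := sum_l int (fun i => (s i)%:Z).
rewrite -[X in X = _ -> _](_ : \sum_i l i *+ s i = _); last first.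
  apply: eq_bigr => i _; rewrite -mulrzr intz -mulr_natl; congr (_ * _).
  by rewrite natz.
rewrite H => /esym/eqP; rewrite subr_eq0 => /eqP E.
have pE g : (parity g)%:Z = \sum_k (s (g k))%:Z.
  by rewrite /parity -!natz natr_sum; apply: eq_bigr => k _; rewrite natz.
by have := E; rewrite -!pE => -[].
Qed.

Let U t : R[i] := \sum_i (c i * (-1) ^+ s i)%:C * expi (t * lam i).

Let powerE t : U t ^+ n =
  \sum_f ((weight f * (-1) ^+ parity f)%:C * expi (t * freq f)).
Proof.
rewrite -[n in LHS]card_ord -prodr_const bigA_distr_bigA /=.
apply: eq_bigr => f _; rewrite big_split /= -rmorph_prod big_split /=.
by rewrite prodrXr -expi_sum -mulr_sumr.
Qed.

(** Group the words by letter counts: there are at most [n.+1 ^ #|I|] classes of total weight 1, and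
    no class weighs more than [rho ^+ n], because its words share one frequency. *)
Lemma word_count_bound (rho t0 : R) : (forall t, t0 <= t -> normc (U t) <= rho) ->
  1 <= n.+1%:R ^+ #|I| * rho ^+ n.
Proof.
move=> Urho.
pose tau f : {ffun I -> 'I_n.+1} := [ffun i => inord (letters f i)].
have tauE f i : tau f i = letters f i :> nat.
  by rewrite ffunE inordK // ltnS -[X in (_ <= X)%N]card_ord max_card.
have w_ge0 f : 0 <= weight f by apply: prodr_ge0.
have w_sum : \sum_f weight f = 1.
  by rewrite -(bigA_distr_bigA (fun (_ : 'I_n) i => c i)) /= prodr_const c_sum expr1n.
have rho_ge0 : 0 <= rho by apply: le_trans (Urho t0 (lexx _)); exact: normc_ge0.
have type_bound k : \sum_(f | tau f == k) weight f <= rho ^+ n.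
  have [w0|/eqP w0] := pselect (\sum_(f | tau f == k) weight f = 0).
    by rewrite w0 exprn_ge0.
  have [f0 /andP [/eqP f0k wf0]] : exists f, (tau f == k) && (weight f != 0).
    apply/existsP; apply: contraNT w0 => /existsPn w0; apply/eqP/big1 => f fk.
    by apply/eqP; have := w0 f; rewrite fk /= negbK.
  have freq_tau f : tau f = k -> freq f = freq f0.
    move=> fk; rewrite /freq !sum_letters; apply: eq_bigr => i _.
    by rewrite -!tauE fk f0k.
  (* Several classes may share the frequency of [f0]. By [parity_eq] all their words of non-zero
     weight have the same sign, so nothing cancels and the norm of [A0] is their total weight. *)
  pose A0 : R[i] := \sum_(f | freq f == freq f0) (weight f * (-1) ^+ parity f)%:C.
  apply: (@le_trans _ _ (normc A0)).
    have -> : A0 = ((\sum_(f | freq f == freq f0) weight f) * (-1) ^+ parity f0)%:C.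
      rewrite mulr_suml rmorph_sum; apply: eq_bigr => f /eqP ff0.
      have [->|wf] := eqVneq (weight f) 0; first by rewrite !mul0r.
      by rewrite (parity_eq wf wf0 ff0).
    rewrite normc_real normrM normrX normrN1 expr1n mulr1 ger0_norm ?sumr_ge0 //.
    rewrite [leLHS]big_mkcond [leRHS]big_mkcond /=; apply: ler_sum => f _.
    case: eqP => [/freq_tau ->|_]; first by rewrite eqxx.
    by case: ifP.
  pose r := [seq f <- enum {ffun 'I_n -> I} | freq f != freq f0].
  apply: (@constant_term_bound _ r (fun f => (weight f * (-1) ^+ parity f)%:C)
    (fun f => freq f - freq f0) _ _ t0) => [f|t t0t].
    by rewrite mem_filter subr_eq0 => /andP [].
  (* A unimodular phase moves the frequency of [f0] to zero, which makes [A0] the constant term. *)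
  have -> : A0 + \sum_(f <- r) (weight f * (-1) ^+ parity f)%:C *
      expi (t * (freq f - freq f0)) = U t ^+ n * expi (- (t * freq f0)).
    rewrite powerE mulr_suml [RHS](bigID (fun f => freq f == freq f0)) /=; congr (_ + _).
      apply: eq_bigr => f /eqP ->; rewrite -mulrA -expiD subrr expi0 mulr1 //.
    rewrite big_filter big_enum_cond /=; apply: eq_bigr => f _.
    by rewrite -mulrA -expiD -mulrBr.
  rewrite normcM normc_expi mulr1 normcX lerXn2r ?nnegrE ?normc_ge0 //.
  exact: Urho.
rewrite -[leLHS]w_sum (partition_big tau predT) //=.
apply: (@le_trans _ _ (\sum_(k : {ffun I -> 'I_n.+1}) rho ^+ n)).
  by apply: ler_sum => k _; exact: type_bound.
by rewrite sumr_const card_ffun card_ord -[leLHS]mulr_natl natrX.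
Qed.
End Words.

Theorem amplitude_bound_ge1 (I : finType) (lam c : I -> R) (s : I -> bool)
    (rho t0 : R) :
  (forall i, 0 <= c i) -> \sum_i c i = 1 ->
  (forall l : I -> int, (forall i, l i != 0 -> c i != 0) ->
     \sum_i l i = 0 -> \sum_i lam i *~ l i = 0 -> \sum_i l i *+ s i = 0) ->
  (forall t, t0 <= t ->
     normc (\sum_i (c i * (-1) ^+ s i)%:C * expi (t * lam i)) <= rho) ->
  1 <= rho.
Proof.
move=> c0 c1 rel Urho; apply: (@poly_geometric_lt1 #|I|) => [|n].
  by apply: le_trans (Urho t0 (lexx _)); exact: normc_ge0.
exact: (word_count_bound c0 c1 rel n Urho).
Qed.
End AlmostPeriodic.

(** * Matrix exponentials and pretty good state transfer *)

Section ExpMatrix.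
Local Open Scope classical_set_scope.
Variable R : realType.
Local Notation normc := (@ComplexField.Normc.normc R).
Local Notation "x %:C" := (real_complex R x).

Lemma expmx_entry (K : numFieldType) (n : nat) (A : 'M[K]_n) (u v : 'I_n)
    (a d E : 'I_n -> K) :
  (forall k, (A ^+ k) u v = \sum_j a j * d j ^+ k) ->
  (forall j, (fun m : nat => \sum_(0 <= k < m) (k`!%:R)^-1 * d j ^+ k) @ \oo --> E j) ->
  expmx A u v = \sum_j a j * E j.
Proof.
move=> AE cvE; rewrite mxE; apply/cvg_lim => //.
rewrite (_ : (fun m : nat => _) =
   (fun m : nat => \sum_j a j * \sum_(0 <= k < m) (k`!%:R)^-1 * d j ^+ k)).
  apply: cvg_big => [|j _]; first exact: add_continuous.
  apply: cvgM => //; exact: cvg_cst.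
apply/funext => m; rewrite summxE; under eq_bigr => k _ do rewrite mxE AE mulr_sumr.
rewrite exchange_big; apply: eq_bigr => j _ /=.
by rewrite mulr_sumr; apply: eq_bigr => k _; rewrite mulrCA.
Qed.

Lemma expi_partial_sum (x : R) (m : nat) :
  \sum_(0 <= k < m) (k`!%:R)^-1 * (Complex 0 x) ^+ k =
  Complex (series (cos_coeff x) m) (series (sin_coeff x) m) :> R[i].
Proof.
elim: m => [|m IHm]; first by rewrite /series /= !big_geq.
rewrite big_nat_recr //= IHm /series /= !big_nat_recr //=.
have powE : (Complex 0 x) ^+ m = (x ^+ m)%:C * Complex ((~~ odd m)%:R * (-1) ^+ m./2)
    ((odd m)%:R * (-1) ^+ m.-1./2).
  have x_i : Complex 0 x = x%:C * 'i%C.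
    by apply/eqP; rewrite eq_complex /=; apply/andP; split; apply/eqP; ring.
  rewrite x_i exprMn -rmorphXn; congr (_ * _).
  rewrite -[m in LHS]odd_double_half exprD -muln2 mulnC exprM sqr_i.
  have -> : (-1 : R[i]) ^+ m./2 = ((-1) ^+ m./2)%:C by rewrite rmorphXn rmorphN1.
  case: (boolP (odd m)) => mo; apply/eqP; rewrite eq_complex /=.
    have -> : m.-1./2 = m./2 by rewrite -{1}[m]odd_double_half mo /= doubleK.
    by apply/andP; split; apply/eqP; ring.
  by apply/andP; split; apply/eqP; ring.
rewrite powE.
have -> : (m`!%:R)^-1 = ((m`!%:R)^-1)%:C :> R[i] by rewrite fmorphV rmorph_nat.
apply/eqP; rewrite eq_complex /= !mul0r !subr0 !addr0; apply/andP.
by split; apply/eqP; congr (_ + _); rewrite /cos_coeff /sin_coeff /= -?exprnP; ring.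
Qed.

Lemma complex_cvg (a b : nat -> R) (x y : R) :
  a @ \oo --> x -> b @ \oo --> y ->
  (fun m => Complex (a m) (b m) : (R[i] : numFieldType)) @ \oo -->
  (Complex x y : (R[i] : numFieldType)).
Proof.
move=> ax by_; apply/(@cvgrPdist_lt (R[i] : numFieldType)) => e e0.
(* A positive complex number is real, so the radius can be halved in [R]. *)
have eE : e = (complex.Re e)%:C.
  by move: e0; case: e => ea eb; rewrite ltcE /= => /andP[/eqP -> _].
have e20 : 0 < complex.Re e / 2.
  by rewrite divr_gt0 //; move: e0; rewrite {1}eE ltcR.
near=> m.
have am : `|x - a m| < complex.Re e / 2 by near: m; move/cvgrPdist_lt : ax; exact.
have bm : `|y - b m| < complex.Re e / 2 by near: m; move/cvgrPdist_lt : by_; exact.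
rewrite eE -[`|_|]/((normc (Complex x y - Complex (a m) (b m)))%:C) ltcR.
have -> : Complex x y - Complex (a m) (b m) =
  (x - a m)%:C + 'i%C * (y - b m)%:C.
  by apply/eqP; rewrite eq_complex /=; apply/andP; split; apply/eqP; ring.
apply: le_lt_trans (normcD _ _) _; rewrite normcM !normc_real.
have -> : normc 'i%C = 1 by rewrite /ComplexField.Normc.normc expr0n expr1n add0r sqrtr1.
by rewrite mul1r [ltRHS]splitr ltrD.
Unshelve. all: by end_near. Qed.

Lemma expi_cvg (x : R) :
  (fun m : nat => \sum_(0 <= k < m) (k`!%:R)^-1 * (Complex 0 x) ^+ k) @ \oo -->
  (expi x : (R[i] : numFieldType)).
Proof.
rewrite (_ : (fun m : nat => _) = fun m =>
  Complex (series (cos_coeff x) m) (series (sin_coeff x) m) :> R[i]).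
  apply: complex_cvg.
    have -> : cos x = limn (series (cos_coeff x)) by rewrite unlock.
     exact: is_cvg_series_cos_coeff.
  have -> : sin x = limn (series (sin_coeff x)) by rewrite unlock.
   exact: is_cvg_series_sin_coeff.
by apply/funext => m; rewrite expi_partial_sum.
Qed.

(** [P] is the unitary matrix of the spectral theorem for the complexified [N], with left
    eigenvectors as rows. The second clause is the orthonormality of its columns, which later makes
    the masses sum to 1. *)
Theorem expmx_spectral (n : nat) (N : 'M[R]_n) : N^T = N ->
  exists (P : 'M[R[i]]_n) (lam : 'I_n -> R),
   [/\ forall j v, \sum_k P j k * (N k v)%:C = (lam j)%:C * P j v,
      forall u v, \sum_j (P j u)^* * P j v = (u == v)%:R &
      forall t u v, expmx ((Complex 0 t) *: map_mx (real_complex R) N) u v =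
        \sum_j ((P j u)^* * P j v) * expi (t * lam j)].
Proof.
move=> Nsym; pose M := map_mx (real_complex R) N.
have MH : M \is hermsymmx.
  apply/is_hermitianmxP; rewrite expr0 scale1r.
  by apply/matrixP => i j; rewrite !mxE conj_Creal ?complex_real //= -{1}Nsym mxE.
pose P := spectralmx M; pose D := spectral_diag M.
have PU : P \is unitarymx by exact: spectral_unitarymx.
have ME : M = invmx P *m diag_mx D *m P by apply/orthomx_spectralP/hermitian_normalmx.
have Dreal := hermitian_spectral_diag_real MH.
pose lam j := complex.Re (D 0 j).
have lamE j : (lam j)%:C = D 0 j.
  by rewrite /lam RRe_real //; move/mxOverP: Dreal; exact.
have PM : P *m M = diag_mx D *m P by rewrite ME !mulmxA mulmxV ?mul1mx // unitarymx_unit.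
have PMe j v : \sum_k P j k * (N k v)%:C = (lam j)%:C * P j v.
  have := congr1 (fun X : 'M[R[i]]_n => X j v) PM; rewrite mul_diag_mx !mxE lamE => <-.
  by apply: eq_bigr => k _; rewrite mxE.
have PPt : P *m (P^t*)%sesqui = 1%:M by apply/unitarymxP.
have PtP : (P^t*)%sesqui *m P = 1%:M by apply: mulmx1C.
have Pinv u v : \sum_j (P j u)^* * P j v = (u == v)%:R.
  have := congr1 (fun X : 'M[R[i]]_n => X u v) PtP; rewrite !mxE => <-.
  by apply: eq_bigr => j _; rewrite !mxE.
exists P, lam; split=> //.
move=> t u v; apply: (expmx_entry (d := fun j => Complex 0 (t * lam j))) => [k|j]; last first.
  exact: expi_cvg.
have PA j x : (P *m ((Complex 0 t *: M) ^+ k)) j x = Complex 0 (t * lam j) ^+ k * P j x.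
  elim: k x => [|k IHk] x; first by rewrite !expr0 mulmx1 mul1r.
  rewrite exprSr -mulmxE mulmxA mxE.
  under eq_bigr => y _ do rewrite IHk !mxE.
  have -> : Complex 0 (t * lam j) = Complex 0 t * (lam j)%:C.
    by apply/eqP; rewrite eq_complex /=; apply/andP; split; apply/eqP; ring.
  rewrite exprSr -[in RHS]mulrA -[in RHS]mulrA -PMe !mulr_sumr.
  by apply: eq_bigr => y _; rewrite -mulrA [P j y * _]mulrCA.
have -> : (Complex 0 t *: M) ^+ k = (P^t*)%sesqui *m (P *m (Complex 0 t *: M) ^+ k).
  by rewrite mulmxA PtP mul1mx.
by rewrite mxE; apply: eq_bigr => j _; rewrite PA !mxE mulrA mulrAC.
Qed.
End ExpMatrix.

Section Criterion.
Local Open Scope classical_set_scope.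
Variable R : realType.
Local Notation normc := (@ComplexField.Normc.normc R).
Local Notation "x %:C" := (real_complex R x).

Lemma limf_esup_pinfty_eq1 (f : R -> R) :
  (forall t, 0 <= f t <= 1) ->
  (forall rho t0, (forall t, t0 <= t -> f t <= rho) -> 1 <= rho) ->
  limf_esup (fun t => (f t)%:E) +oo%R = 1%:E.
Proof.
move=> f01 frho; rewrite limf_esupE; apply/eqP; rewrite eq_le; apply/andP; split.
  apply: (@le_trans _ _ (ereal_sup ((fun t => (f t)%:E) @` setT))).
    by apply: ereal_inf_lbound; exists setT => //; exact: filterT.
  by apply: ge_ereal_sup => _ [t _ <-]; rewrite lee_fin; case/andP: (f01 t).
apply: le_ereal_inf_tmp => _ [V [t0 [_ t0V]] <-].
set s := ereal_sup _.
have fs t : t0 < t -> ((f t)%:E <= s)%E.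
  by move=> /t0V Vt; apply: ereal_sup_ubound; exists t.
case sE : s fs => [r| |] fs; last 2 first.
- by rewrite leey.
- by have := fs (t0 + 1) (ltr_pwDr ltr01 (lexx _)); rewrite leeNy_eq.
(* A neighbourhood of infinity contains an open half-line, whereas [frho] speaks of a closed one;
   hence the shift by 1. *)
rewrite lee_fin; apply: (frho r (t0 + 1)) => t tt0.
by have := fs t (lt_le_trans (ltr_pwDr ltr01 (lexx _)) tt0); rewrite lee_fin.
Qed.

Lemma entry_enum_val (T : finType) (K : pzRingType) (S : {set T}) (M : 'M[K]_#|S|)
    (i j : 'I_#|S|) : entry M (enum_val i) (enum_val j) = M i j.
Proof.
rewrite /entry (big_pred1 i) => [|k]; last exact/inj_eq/enum_val_inj.
by rewrite (big_pred1 j) // => k; exact/inj_eq/enum_val_inj.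
Qed.

(** The hypothesis ranges over all orthonormal eigenbases, as the spectral theorem does not say
    which one it yields. The masses are the squared norms of the entries [P j iu], and [s j] marks
    the eigenvectors that are antisymmetric on the pair. *)
Theorem PGST_criterion (T : finType) (S : {set T}) (N : 'M[R]_#|S|)
    (iu iv : 'I_#|S|) :
  N^T = N ->
  (forall (P : 'M[R[i]]_#|S|) (lam : 'I_#|S| -> R),
    (forall j v, \sum_k P j k * (N k v)%:C = (lam j)%:C * P j v) ->
    (forall u v, \sum_j (P j u)^* * P j v = (u == v)%:R) ->
    exists s : 'I_#|S| -> bool, (forall j, P j iv = (-1) ^+ s j * P j iu) /\
    forall l : 'I_#|S| -> int, (forall j, l j != 0 -> P j iu != 0) ->
      \sum_j l j = 0 -> \sum_j lam j *~ l j = 0 -> \sum_j l j *+ s j = 0) ->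
  PGST N (enum_val iu) (enum_val iv).
Proof.
move=> Nsym H; have [P [lam [eig orth_c expE]]] := expmx_spectral Nsym.
have [s [Ps rel]] := H P lam eig orth_c.
pose c j := normc (P j iu) ^+ 2.
have c_ge0 j : 0 <= c j by rewrite sqr_ge0.
have conjP j : (P j iu)^* * P j iu = (c j)%:C.
  by rewrite mulrC -normCK /c rmorphXn.
have c_sum : \sum_j c j = 1.
  apply: (@complexI R); rewrite rmorph_sum rmorph1 /=.
  under eq_bigr => j _ do rewrite -conjP.
  by rewrite orth_c eqxx.
have UE t : entry (expmx ((Complex 0 t) *: map_mx (real_complex R) N))
    (enum_val iu) (enum_val iv) = \sum_j (c j * (-1) ^+ s j)%:C * expi (t * lam j).
  rewrite entry_enum_val expE; apply: eq_bigr => j _; congr (_ * _).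
  have sgnE : ((-1) ^+ s j)%:C = (-1) ^+ s j :> R[i] by rewrite rmorphXn rmorphN1.
  by rewrite Ps mulrCA conjP -sgnE -rmorphM mulrC.
rewrite /PGST; apply: limf_esup_pinfty_eq1 => [t|rho t0 Urho].
  rewrite normc_ge0 UE /=; apply: (@le_trans _ _ (\sum_j c j)); last by rewrite c_sum.
  elim/big_rec2: _ => [|j a b _ ab].
    by rewrite ComplexField.Normc.normc0.
  apply: le_trans (normcD _ _) _; rewrite lerD // normcM normc_expi mulr1 normc_real.
  by rewrite normrM normr_sign mulr1 ger0_norm.
apply: (amplitude_bound_ge1 (lam := lam) (c := c) (s := s) (t0 := t0)) => //.
  move=> l lc; apply: rel => j lj; apply: contra_neq (lc j lj) => Pj.
  by rewrite /c Pj ComplexField.Normc.normc0 expr0n.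
by move=> t tt0; rewrite -UE; exact: Urho.
Qed.
End Criterion.

(** * Eigenvectors and the resolvent *)

(* Multiplying the resolvent identity [b^* (z - N)^-1 b = q / p] by the
   denominators and evaluating at [lam i] isolates the residue
   [\sum_(lam j = lam i) |beta j|^2]. *)
Lemma eigenvector_orthogonal (C : numClosedFieldType) (n : nat)
    (N P : 'M[C]_n) (lam b : 'I_n -> C) (X : 'I_n -> {poly C}) (D p q : {poly C}) :
  (forall j v, \sum_k P j k * N k v = lam j * P j v) ->
  (forall u v, \sum_j (P j u)^* * P j v = (u == v)%:R) ->
  D != 0 ->
  (forall k, 'X * X k - \sum_v (N k v)%:P * X v = D * p * (b k)%:P) ->
  \sum_k ((b k)^*)%:P * X k = D * q ->
  forall i, p.[lam i] != 0 -> \sum_k P i k * b k = 0.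
Proof.
move=> eig orth D0 XE XD i pi0.
(* In the eigenbasis, with [y] and [beta] for the coordinates of [X] and [b], the system for [X]
   becomes diagonal. *)
pose y j := \sum_k (P j k)%:P * X k.
pose beta j := \sum_k P j k * b k.
have yE j : ('X - (lam j)%:P) * y j = D * p * (beta j)%:P.
  have -> : D * p * (beta j)%:P = \sum_k (P j k)%:P * (D * p * (b k)%:P).
    rewrite /beta rmorph_sum mulr_sumr /=; apply: eq_bigr => k _.
    by rewrite rmorphM /= mulrCA.
  under eq_bigr => k _ do rewrite -XE mulrBr mulrCA.
  rewrite sumrB -mulr_sumr mulrBl; congr (_ - _).
  under [RHS]eq_bigr => k _ do rewrite mulr_sumr.
  rewrite exchange_big /= /y mulr_sumr; apply: eq_bigr => v _.
  rewrite mulrA -rmorphM /= -eig rmorph_sum mulr_suml; apply: eq_bigr => k _ /=.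
  by rewrite rmorphM mulrA.
have sumE : \sum_j ((beta j)^*)%:P * y j = D * q.
  rewrite -XD /y; under eq_bigr => j _ do rewrite mulr_sumr.
  rewrite exchange_big /=; apply: eq_bigr => k _.
  under eq_bigr => j _ do rewrite mulrA -rmorphM.
  rewrite -mulr_suml -rmorph_sum; congr (_%:P * _).
  have -> : (b k)^* = \sum_l (b l)^* * (l == k)%:R.
    by rewrite (bigD1 k) //= eqxx mulr1 big1 ?addr0 // => l /negPf ->; rewrite mulr0.
  under [RHS]eq_bigr => l _ do rewrite -orth mulr_sumr.
  rewrite exchange_big /=; apply: eq_bigr => j _.
  rewrite /beta rmorph_sum mulr_suml; apply: eq_bigr => l _ /=.
  by rewrite rmorphM mulrAC mulrA mulrC mulrA.
pose W := \prod_(j | lam j != lam i) ('X - (lam j)%:P).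
pose Wj j := \prod_(k | (lam k != lam i) && (k != j)) ('X - (lam k)%:P).
have WE j : lam j != lam i -> W = ('X - (lam j)%:P) * Wj j.
  by move=> lj; rewrite /W (bigD1 j).
pose S := \sum_(j | lam j == lam i) (beta j)^* * beta j.
pose rest := \sum_(j | lam j != lam i) ((beta j)^* * beta j)%:P * (p * Wj j).
(* The identity [sumE] after multiplication by [('X - lam i) * W], which cancels every denominator.
   At [lam i] only the first term survives, and [W] and [p] do not vanish there, so the sum of
   squared norms [S] is zero. *)
have key : W * p * S%:P + ('X - (lam i)%:P) * rest = ('X - (lam i)%:P) * W * q.
  apply: (mulfI D0).
  have -> : D * (('X - (lam i)%:P) * W * q) =
     ('X - (lam i)%:P) * W * \sum_j ((beta j)^*)%:P * y j by rewrite sumE; ring.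
  rewrite (bigID (fun j => lam j == lam i)) /= mulrDr mulrDr; congr (_ + _).
    rewrite /S rmorph_sum !mulr_sumr; apply: eq_bigr => j /eqP lj.
    have := yE j; rewrite lj => E.
    rewrite rmorphM /=.
    have -> : ('X - (lam i)%:P) * W * (((beta j)^*)%:P * y j) =
        W * ((beta j)^*)%:P * (('X - (lam i)%:P) * y j) by ring.
    rewrite E; ring.
  rewrite /rest !mulr_sumr; apply: eq_bigr => j lj.
  rewrite (WE j lj) rmorphM /=.
  have -> : ('X - (lam i)%:P) * (('X - (lam j)%:P) * Wj j) * (((beta j)^*)%:P * y j) =
    ('X - (lam i)%:P) * Wj j * ((beta j)^*)%:P * (('X - (lam j)%:P) * y j) by ring.
  rewrite yE; ring.
have : (W * p * S%:P).[lam i] = 0.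
  have := congr1 (horner^~ (lam i)) key.
  by rewrite !hornerE subrr !mul0r addr0.
rewrite !hornerM hornerC => /eqP; rewrite !mulf_eq0 (negPf pi0) orbF.
have /negPf -> : W.[lam i] != 0.
  rewrite /W horner_prod; apply/prodf_neq0 => j lj.
  by rewrite !hornerE subr_eq0 eq_sym.
rewrite /= /S psumr_eq0 => [|j _]; last by rewrite mulrC mul_conjC_ge0.
move/allP => /(_ i (mem_index_enum _)); rewrite eqxx /= mulf_eq0 conjC_eq0 orbb.
by move/eqP.
Qed.

(** * Cospectral vertices, paths and gluing *)

Section GraphVectors.
Variable T : finType.

Lemma char_poly_reindex (R : comNzRingType) (n m : nat) (A : 'M[R]_m)
    (g : 'I_n -> 'I_m) : n = m -> injective g ->
  char_poly (\matrix_(i, j) A (g i) (g j)) = char_poly A.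
Proof.
move=> nm; subst m => g_inj; pose s := perm g_inj.
rewrite /char_poly.
have -> : char_poly_mx (\matrix_(i, j) A (g i) (g j)) =
    row_perm s (col_perm s (char_poly_mx A)).
  by apply/matrixP => i j; rewrite !mxE !permE (inj_eq g_inj).
rewrite row_permE col_permE !det_mulmx !det_perm odd_permV mulrCA mulrA.
by rewrite -mulrA -expr2 sqrr_sign mulr1.
Qed.

(** This is where cospectrality enters: it makes the diagonal cofactors at [u] and [v] equal. *)
Lemma adjugate_char_poly_del (R : comNzRingType) (G : sgraph T)
    (i : 'I_#|vset G|) :
  \adj (char_poly_mx (adjmx R G)) i i =
  char_poly (adjmx R (del_vertex G (enum_val i))).
Proof.
rewrite mxE /cofactor addnn -signr_odd odd_double expr0 mul1r.
rewrite row'_col'_char_poly_mx -/(char_poly _).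
set u := enum_val i; pose S := vset (del_vertex G u).
have memS (a : 'I_#|S|) : (enum_val a != u) && (enum_val a \in vset G).
  by have := enum_valP a; rewrite !inE.
have idx (a : 'I_#|S|) : exists b : 'I_#|vset G|.-1, enum_val (lift i b) = enum_val a.
  have /andP [au aG] := memS a.
  have ia : i != enum_rank_in aG (enum_val a).
    apply: contraNneq au => iE; apply/eqP.
    by rewrite /u iE enum_rankK_in.
  case: (unliftP i (enum_rank_in aG (enum_val a))) ia => [b bE _|->]; last by rewrite eqxx.
  by exists b; rewrite -bE enum_rankK_in.
have [g gE] := fin_all_exists idx.
have g_inj : injective g.
  by move=> a b gab; apply: enum_val_inj; rewrite -!gE gab.
have cardS : #|S| = #|vset G|.-1.
  by rewrite /S /= (cardsD1 u (vset G)) enum_valP.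
rewrite -(char_poly_reindex _ cardS g_inj); congr char_poly.
apply/matrixP => a b; rewrite !mxE !gE /= /del_adj /=.
by have /andP [-> _] := memS a; have /andP [-> _] := memS b; rewrite !andbT.
Qed.

Lemma size_det_affine (R : comNzRingType) (k : nat) (B : 'M[{poly R}]_k) :
  (forall i j, (size (B i j) <= 2)%N) -> (size (\det B) <= k.+1)%N.
Proof.
move=> sB; rewrite /determinant.
apply: (leq_trans (size_sum _ _ _)); apply/bigmax_leqP => t _.
rewrite size_Msign; apply: (leq_trans (size_prod_leq _ _)).
rewrite cardT size_enum_ord leq_subLR addnS ltnS.
apply: (@leq_trans (\sum_(i < k) 2)); first by apply: leq_sum => i _; exact: sB.
by rewrite sum_nat_const card_ord muln2 addnn.
Qed.

Lemma size_adjugate_char_poly_mx (R : comNzRingType) (n : nat) (N : 'M[R]_n) i j :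
  (size (\adj (char_poly_mx N) i j) <= n)%N.
Proof.
case: n N i j => [|n] N i j; first by case: i.
rewrite mxE /cofactor -signr_odd size_Msign; apply: size_det_affine => a b.
rewrite !mxE; apply: (leq_trans (size_polyD _ _)).
rewrite size_polyN geq_max (leq_trans (size_polyC_leq1 _)) // andbT.
by case: eqP => _; rewrite ?mulr1n ?mulr0n ?size_poly0 ?size_polyX.
Qed.

(** The vectors that diagonalize the Schur complement on the pair; [s = true] is the antisymmetric
    one. *)
Definition signed_pair (R : pzRingType) (u v : T) (s : bool) (x : T) : R :=
  (x == u)%:R + (-1) ^+ s * (x == v)%:R.

Lemma sum_enum_val (V : nmodType) (S : {set T}) (F : T -> V) :
  (forall x, x \notin S -> F x = 0) ->
  \sum_x F x = \sum_(i < #|S|) F (enum_val i).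
Proof.
move=> F0; rewrite -big_enum_val /= [RHS]big_mkcond; apply: eq_bigr => x _.
by case: ifP => // /negbT /F0.
Qed.

(** Apply the adjugate of ['X - A] to the signed pair. The adjugate is symmetric with equal diagonal
    entries at [u] and [v], so the result is again a multiple of the signed pair on these two
    vertices. *)
Lemma cospectral_vectors (R : comNzRingType) (G : sgraph T) (u v : T) :
  u \in vset G -> v \in vset G -> u != v -> cospectral R G u v ->
  exists q : bool -> {poly R}, [/\ forall s, q s \is monic,
    forall s, size (q s) = #|vset G| & forall s, exists Y : T -> {poly R},
   [/\ forall x, x \notin vset G -> Y x = 0,
       Y u = q s, Y v = (-1) ^+ s * q s &
       forall x, 'X * Y x - \sum_y (adj G x y)%:R * Y y =
         char_poly (adjmx R G) * signed_pair _ u v s x]].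
Proof.
move=> uG vG uv cosp.
pose iu := enum_rank_in uG u; pose iv := enum_rank_in uG v.
have iuE : enum_val iu = u by rewrite enum_rankK_in.
have ivE : enum_val iv = v by rewrite enum_rankK_in.
have iuv : iu != iv by rewrite -(inj_eq enum_val_inj) iuE ivE.
pose M := char_poly_mx (adjmx R G); pose A := \adj M.
have Asym i j : A i j = A j i.
  have MT : M^T = M.
    by apply/matrixP => a b; rewrite !mxE adj_sym eq_sym.
  by rewrite /A -[in LHS]MT -trmx_adj mxE.
have Auv : A iu iu = A iv iv by rewrite /A !adjugate_char_poly_del iuE ivE.
pose q (s : bool) := A iu iu + (-1) ^+ s * A iu iv.
pose n := #|vset G|.
have MA i j : 'X * A i j - \sum_k (adjmx R G i k)%:P * A k j =
    char_poly (adjmx R G) *+ (i == j).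
  have MAE : \sum_k M i k * A k j = char_poly (adjmx R G) *+ (i == j).
    have := congr1 (fun B : 'M[{poly R}]_n => B i j) (mul_mx_adj M).
    by rewrite [LHS]mxE [RHS]mxE.
  have ME k : M i k = 'X *+ (i == k) - (adjmx R G i k)%:P by rewrite !mxE.
  rewrite -MAE; under [RHS]eq_bigr => k _ do rewrite ME mulrBl.
  rewrite sumrB; congr (_ - _); rewrite (bigD1 i) //= eqxx mulr1n.
  rewrite big1 ?addr0 // => k ki.
  by rewrite eq_sym (negPf ki) mulr0n mul0r.
have szuu : size (A iu iu) = n.
  rewrite /A adjugate_char_poly_del size_char_poly /=.
  by rewrite /n (cardsD1 (enum_val iu) (vset G)) enum_valP.
(* The general bound on cofactors gives only size [n]. The equation of row [iu] gains one degree: it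
   writes ['X * A iu iv] as a combination of cofactors. *)
have szuv : (size (A iu iv) < n)%N.
  have [->|Auv0] := eqVneq (A iu iv) 0.
    by rewrite size_poly0 /n (cardsD1 u (vset G)) uG.
  rewrite -(size_mulX Auv0) mulrC.
  have := MA iu iv; rewrite (negPf iuv) mulr0n => /eqP; rewrite subr_eq0 => /eqP ->.
  apply: (leq_trans (size_sum _ _ _)); apply/bigmax_leqP => k _.
  rewrite mul_polyC; apply: (leq_trans (size_scale_leq _ _)).
  exact: size_adjugate_char_poly_mx.
have szq (s : bool) : (size ((-1) ^+ s * A iu iv)%R < size (A iu iu))%N.
  by rewrite -signr_odd size_Msign szuu.
exists q; split=> s.
- by rewrite monicE lead_coefDl // /A adjugate_char_poly_del; exact: char_poly_monic.
- by rewrite size_polyDl // szuu.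
pose Y x := if x \in vset G then
  A (enum_rank_in uG x) iu + (-1) ^+ s * A (enum_rank_in uG x) iv else 0.
have Y0 x : x \notin vset G -> Y x = 0 by rewrite /Y => /negPf ->.
have YE i : Y (enum_val i) = A i iu + (-1) ^+ s * A i iv.
  by rewrite /Y enum_valP enum_valK_in.
exists Y; split=> //.
- by rewrite -iuE YE.
- rewrite -ivE YE -Auv Asym /q mulrDr mulrA -expr2 sqrr_sign mul1r addrC //.
move=> x; have [xG|xG] := boolP (x \in vset G); last first.
  rewrite Y0 // mulr0 big1 => [|y _]; last first.
    case: (boolP (adj G x y)) => [/adj_vset/andP[]|]; first by rewrite (negPf xG).
    by rewrite mul0r.
  rewrite /signed_pair; case: eqP xG => [->|_ xG]; first by rewrite uG.
  by case: eqP xG => [->|_ _]; rewrite ?vG // !(mulr0, addr0, subr0).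
pose i := enum_rank_in uG x; have iE : enum_val i = x by rewrite enum_rankK_in.
rewrite (@sum_enum_val _ (vset G)) => [|y yG]; last by rewrite Y0 ?mulr0.
rewrite -{1}iE YE.
under eq_bigr => j _ do rewrite YE mulrDr mulrCA.
rewrite big_split /= -mulr_sumr mulrDr mulrCA opprD addrACA -mulrBr.
have adjE j : (adj G x (enum_val j))%:R = (adjmx R G i j)%:P :> {poly R}.
  by rewrite mxE iE; case: (adj G _ _); rewrite ?rmorph1 ?rmorph0.
under eq_bigr => j _ do rewrite adjE.
under [X in _ + _ * (_ - X)]eq_bigr => j _ do rewrite adjE.
rewrite !MA /signed_pair -(inj_eq enum_val_inj) iE iuE -(inj_eq enum_val_inj) iE ivE.
by rewrite mulrDr mulrCA !mulr_natr.
Qed.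

(** The Chebyshev-type recurrence that an eigenvector satisfies along a path. *)
Fixpoint chain (R : nzRingType) (f0 f1 : {poly R}) (n : nat) : {poly R} :=
  if n is n1.+1 then
    (if n1 is n2.+1 then 'X * chain f0 f1 n1 - chain f0 f1 n2 else f1)
  else f0.

(** An antisymmetric solution vanishes at the centre. For a symmetric one the equation at the centre
    is [('X - a) * Z0 = 2 * Z1], and the choice [Z0 = 2] makes the next value monic. *)
Definition path_start (R : nzRingType) (s : bool) : {poly R} :=
  if s then 0 else 2%:R.
Definition path_next (R : nzRingType) (a : R) (s : bool) : {poly R} :=
  if s then 1 else 'X - a%:P.
(* Value at distance [n] from the centre of the symmetric ([s = false]) or
   antisymmetric ([s = true]) solution of [(z - A) Z = 0] along the path, where
   [a] is the potential at the centre. *)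
Definition path_poly (R : nzRingType) (a : R) (s : bool) (n : nat) : {poly R} :=
  chain (path_start R s) (path_next a s) n.

Lemma path_polySS (R : nzRingType) (a : R) s n :
  path_poly a s n.+2 = 'X * path_poly a s n.+1 - path_poly a s n.
Proof. by []. Qed.

(** The recurrence solves the equation at every inner vertex. At an endpoint the outer neighbour is
    missing, and the defect is the value that the recurrence would take there, at distance
    [m.+2]. *)
Lemma path_vectors (R : comNzRingType) (a : R) (m : nat) (u v w : T)
    (p : (m.+1.*2.+1).-tuple T) (s : bool) :
  uniq p -> nth u p 0 = u -> nth u p m.+1.*2 = v -> nth u p m.+1 = w ->
  exists Z : T -> {poly R},
   [/\ forall x, x \notin vset (path_graph p) -> Z x = 0,
       Z u = path_poly a s m.+1, Z v = (-1) ^+ s * path_poly a s m.+1 &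
       forall x, 'X * Z x - \sum_y (adj (path_graph p) x y)%:R * Z y
           - (x == w)%:R * a%:P * Z x =
         path_poly a s m.+2 * signed_pair _ u v s x].
Proof.
move=> p_uniq p0 pl pm.
have szp : size p = m.+1.*2.+1 by rewrite size_tuple.
pose f := path_poly a s.
pose z i := if (i <= m.+1)%N then f (m.+1 - i)%N else (-1) ^+ s * f (i - m.+1)%N.
pose Z x := if x \in p then z (index x p) else 0.
have Znth i : (i < size p)%N -> Z (nth u p i) = z i.
  by move=> ip; rewrite /Z mem_nth // index_uniq.
have sumN i : (i < size p)%N ->
    \sum_y (adj (path_graph p) (nth u p i) y)%:R * Z y =
    (if (i.+1 < size p)%N then z i.+1 else 0) + (if (0 < i)%N then z i.-1 else 0).
  move=> ip.
  have -> : \sum_y (adj (path_graph p) (nth u p i) y)%:R * Z y =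
      \sum_(y <- p) (adj (path_graph p) (nth u p i) y)%:R * Z y.
    rewrite [RHS]big_uniq //= [RHS]big_mkcond; apply: eq_bigr => y _.
    by case: ifP => // /negbT yp; rewrite /Z (negPf yp) mulr0.
  rewrite (big_nth u) big_mkord.
  have adjN (j : 'I_(size p)) : adj (path_graph p) (nth u p i) (nth u p j) =
      (i.+1 == j) || (j.+1 == i).
    by rewrite /= /path_adj /= !mem_nth // !index_uniq.
  under eq_bigr => j _ do rewrite adjN Znth //.
  rewrite (eq_bigr (fun j : 'I_(size p) => (i.+1 == j)%:R * z j + (j.+1 == i)%:R * z j));
    last first.
    move=> j _; case: (altP (i.+1 =P j)) => [<-|_] /=; last by rewrite mul0r add0r.
    by rewrite gtn_eqF ?ltnS ?leqW // mul0r addr0.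
  rewrite big_split /=; congr (_ + _).
    case: ltnP => [ip1|ip1].
      rewrite (bigD1 (Ordinal ip1)) //= eqxx mul1r big1 ?addr0 // => j.
      by rewrite -val_eqE eq_sym /= => /negPf ->; rewrite mul0r.
    rewrite big1 // => j _; rewrite gtn_eqF ?mul0r //.
    exact: leq_trans (ltn_ord j) ip1.
  case: i ip adjN => [|i] ip _ /=; first by rewrite big1 // => j _; rewrite mul0r.
  rewrite (bigD1 (Ordinal (ltnW ip))) //= eqxx mul1r big1 ?addr0 // => j.
  by rewrite -val_eqE eqSS /= => /negPf ->; rewrite mul0r.
exists Z; split.
- by move=> x; rewrite inE /Z => /negPf ->.
- by rewrite -[in Z u]p0 Znth ?szp.
- rewrite -pl Znth ?szp // /z ifF; last by lia.
  by rewrite (_ : (m.+1.*2 - m.+1)%N = m.+1) //; lia.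
have uE : u = nth u p 0 by [].
move=> x; have [xp|xp] := boolP (x \in p); last first.
  have Zx : Z x = 0 by rewrite /Z (negPf xp).
  rewrite Zx big1 => [|y _]; last by rewrite /= /path_adj /= (negPf xp) mul0r.
  have pin i : (i < size p)%N -> x != nth u p i.
    by move=> ip; apply: contraNneq xp => ->; exact: mem_nth.
  have xu : x != u by have := pin 0%N; rewrite p0 szp => ->.
  have xv : x != v by have := pin m.+1.*2; rewrite pl szp => ->.
  have xw : x != w by have := pin m.+1; rewrite pm szp => -> //; lia.
  by rewrite /signed_pair (negPf xu) (negPf xv) (negPf xw) /=; ring.
set i := index x p.
have ip : (i < size p)%N by rewrite index_mem.
have xE : x = nth u p i by rewrite nth_index.
have nthE j y : nth u p j = y -> (j < size p)%N -> (x == y) = (i == j).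
  by move=> <- jp; rewrite xE nth_uniq.
rewrite /signed_pair (nthE _ _ p0) ?szp // (nthE _ _ pl) ?szp //.
rewrite (nthE _ _ pm) ?szp; last by lia.
rewrite xE Znth // sumN // szp /z.
have fSS n : f n.+2 = 'X * f n.+1 - f n by [].
rewrite szp in ip.
have [im|im|im] := ltngtP i m.+1.
- have [d dE] : exists d, (m.+1 = i + d.+1)%N by exists (m - i)%N; lia.
  have dm : i + d = m by lia.
  have i2 : (i.+1 < m.+1.*2.+1)%N by lia.
  have -> : (i == m.+1.*2) = false by lia.
  rewrite i2 /=.
  have -> : (m.+1 - i)%N = d.+1 by lia.
  have -> : (m.+1 - i.+1)%N = d by lia.
  case: (posnP i) => [i0|i_gt0].
    have -> : m = d by lia.
    by rewrite -/(f d.+2) fSS /=; ring.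
  have -> : (i.-1 <= m.+1)%N by lia.
  have -> : (m.+1 - i.-1)%N = d.+2 by lia.
  by rewrite fSS /=; ring.
- have [d dE] : exists d, (i = m.+1 + d.+1)%N by exists (i - m.+2)%N; lia.
  have -> : (i == 0)%N = false by lia.
  have i_gt0 : (0 < i)%N by lia.
  rewrite i_gt0 /=.
  have -> : (i - m.+1)%N = d.+1 by lia.
  have -> : (i.+1 - m.+1)%N = d.+2 by lia.
  (* If the inner neighbour is the centre, [z] gives it no sign. This agrees with the signed formula
     because the central value is 0 in the antisymmetric case. *)
  have -> : (if (i.-1 <= m.+1)%N then f (m.+1 - i.-1)%N
     else (-1) ^+ s * f (i.-1 - m.+1)%N) = (-1) ^+ s * f d :> {poly R}.
    case: (posnP d) => [d0|d0].
      have -> : (i.-1 <= m.+1)%N by lia.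
      have -> : (m.+1 - i.-1)%N = d by lia.
      by rewrite d0 /f /path_poly /= /path_start; move: (s) => -[]; rewrite ?mulr0 ?mul1r.
    have -> : (i.-1 <= m.+1)%N = false by lia.
    by have -> : (i.-1 - m.+1)%N = d by lia.
  case: ltnP => [ilt|ige].
    have -> : (i == m.+1.*2) = false by lia.
    by rewrite fSS /=; ring.
  have -> : (i == m.+1.*2) by lia.
  have -> : m = d by lia.
  by rewrite -/(f d.+2) fSS /=; ring.
- have -> : (i == 0)%N = false by lia.
  have -> : (i == m.+1.*2)%N = false by lia.
  rewrite im; have -> : (m.+2 < m.+1.*2.+1)%N by lia.
  rewrite subnn subSnn /= leqnSn subSnn.
  rewrite /f /path_poly /= /path_start /path_next.
  by move: (s) => -[]; rewrite ?expr0 ?expr1; ring.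
Qed.
End GraphVectors.

Section Gluing.
Variable T : finType.

(** Rescaled by [q2] and [q1], the two solutions agree on the common vertices and glue together. The
    Schur complements [p1 / q1] and [p2 / q2] add up, except that the diagonal ['X] has been counted
    twice. *)
Lemma glued_vectors (R : comNzRingType) (G1 G2 : sgraph T) (u v w : T) (s : bool)
    (a : R) (Y Z : T -> {poly R}) (p1 q1 p2 q2 : {poly R}) :
  vset G1 :&: vset G2 = [set u; v]%SET -> u != v ->
  w \in vset G2 -> w != u -> w != v ->
  (forall x, x \notin vset G1 -> Y x = 0) -> Y u = q1 -> Y v = (-1) ^+ s * q1 ->
  (forall x, 'X * Y x - \sum_y (adj G1 x y)%:R * Y y = p1 * signed_pair _ u v s x) ->
  (forall x, x \notin vset G2 -> Z x = 0) -> Z u = q2 -> Z v = (-1) ^+ s * q2 ->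
  (forall x, 'X * Z x - \sum_y (adj G2 x y)%:R * Z y - (x == w)%:R * a%:P * Z x =
     p2 * signed_pair _ u v s x) ->
  exists X : T -> {poly R},
   [/\ forall x, x \notin vset G1 :|: vset G2 -> X x = 0,
       X u = q1 * q2, X v = (-1) ^+ s * (q1 * q2) &
       forall x, 'X * X x - \sum_y ((adj G1 x y)%:R + (adj G2 x y)%:R) * X y
          - (x == w)%:R * a%:P * X x =
         (q2 * p1 + q1 * (p2 - 'X * q2)) * signed_pair _ u v s x].
Proof.
move=> meet uv wG2 wu wv Y0 Yu Yv Yeq Z0 Zu Zv Zeq.
pose b : T -> {poly R} := signed_pair _ u v s.
have bu : b u = 1 by rewrite /b /signed_pair eqxx (negPf uv) mulr0 addr0.
have bv : b v = (-1) ^+ s.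
  by rewrite /b /signed_pair eqxx eq_sym (negPf uv) mulr1 add0r.
have b0 x : x != u -> x != v -> b x = 0.
  by move=> /negPf xu /negPf xv; rewrite /b /signed_pair xu xv mulr0 addr0.
(* The last term removes the double count on the two common vertices. *)
pose X x := q2 * Y x + q1 * Z x - q1 * q2 * b x.
have meetP x : x \in vset G1 -> x \in vset G2 -> x = u \/ x = v.
  move=> x1 x2; have : x \in vset G1 :&: vset G2 by rewrite inE x1.
  by rewrite meet !inE => /orP[] /eqP; [left|right].
have /andP [u1 u2] : (u \in vset G1) && (u \in vset G2).
  by rewrite -finset.in_setI meet !inE eqxx.
have /andP [v1 v2] : (v \in vset G1) && (v \in vset G2).
  by rewrite -finset.in_setI meet !inE eqxx orbT.
have Xu : X u = q1 * q2 by rewrite /X Yu Zu bu; ring.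
have Xv : X v = (-1) ^+ s * (q1 * q2) by rewrite /X Yv Zv bv; ring.
have X1 x : x \in vset G1 -> X x = q2 * Y x.
  move=> x1; have [x2|x2] := boolP (x \in vset G2).
    case: (meetP x x1 x2) => ->; first by rewrite Xu Yu; ring.
    by rewrite Xv Yv; ring.
  rewrite /X (Z0 _ x2) b0; first by ring.
    by apply: contraNneq x2 => ->.
  by apply: contraNneq x2 => ->.
have X2 x : x \in vset G2 -> X x = q1 * Z x.
  move=> x2; have [x1|x1] := boolP (x \in vset G1).
    case: (meetP x x1 x2) => ->; first by rewrite Xu Zu; ring.
    by rewrite Xv Zv; ring.
  rewrite /X (Y0 _ x1) b0; first by ring.
    by apply: contraNneq x1 => ->.
  by apply: contraNneq x1 => ->.
exists X; split=> //.
  move=> x; rewrite inE negb_or => /andP [x1 x2].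
  rewrite /X Y0 // Z0 // b0 ?mulr0 ?addr0 ?subr0 //.
    by apply: contraNneq x1 => ->.
  by apply: contraNneq x1 => ->.
move=> x; under eq_bigr => y _ do rewrite mulrDl.
rewrite big_split /=.
have -> : \sum_y (adj G1 x y)%:R * X y = q2 * \sum_y (adj G1 x y)%:R * Y y.
  rewrite mulr_sumr; apply: eq_bigr => y _.
  case: (boolP (adj G1 x y)) => [/adj_vset/andP [_ y1]|_]; last by rewrite !mul0r mulr0.
  by rewrite X1 // !mul1r.
have -> : \sum_y (adj G2 x y)%:R * X y = q1 * \sum_y (adj G2 x y)%:R * Z y.
  rewrite mulr_sumr; apply: eq_bigr => y _.
  case: (boolP (adj G2 x y)) => [/adj_vset/andP [_ y1]|_]; last by rewrite !mul0r mulr0.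
  by rewrite X2 // !mul1r.
have -> : (x == w)%:R * a%:P * X x = q1 * ((x == w)%:R * a%:P * Z x).
  have [->|_] := eqVneq x w; last by rewrite !mul0r mulr0.
  by rewrite X2 //; ring.
have /eqP := Yeq x; have /eqP := Zeq x; rewrite -/(b x).
set SZ := \sum_y (adj G2 x y)%:R * Z y; set SY := \sum_y (adj G1 x y)%:R * Y y.
set wZ := (x == w)%:R * a%:P * Z x.
move=> /eqP EZ /eqP EY; rewrite mulrDl.
have -> : 'X * X x - (q2 * SY + q1 * SZ) - q1 * wZ =
   q2 * ('X * Y x - SY) + q1 * ('X * Z x - SZ - wZ) - 'X * (q1 * q2 * b x).
  by rewrite /X; ring.
by rewrite EZ EY; ring.
Qed.
End Gluing.

(** * The polynomials attached to the glued graph *)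

Lemma monic_reduction (F : fieldType) (p q : {poly F}) :
  p \is monic -> q \is monic -> exists g p' q' : {poly F},
   [/\ p = g * p', q = g * q', g \is monic & p' \is monic] /\
   (q' \is monic /\ coprimep p' q').
Proof.
move=> mp mq; pose g0 := gcdp p q.
have g00 : g0 != 0 by rewrite gcdp_eq0 negb_and monic_neq0.
have l0 : lead_coef g0 != 0 by rewrite lead_coef_eq0.
pose g := (lead_coef g0)^-1 *: g0.
have mg : g \is monic by rewrite monicE lead_coefZ mulVf.
have gp : p = g * (p %/ g) by rewrite mulrC divpK // dvdpZl ?invr_eq0 // dvdp_gcdl.
have gq : q = g * (q %/ g) by rewrite mulrC divpK // dvdpZl ?invr_eq0 // dvdp_gcdr.
exists g, (p %/ g), (q %/ g); split; split=> //.
- by move: mp; rewrite {1}gp monicMl.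
- by move: mq; rewrite {1}gq monicMl.
rewrite /g !divpZr ?invr_eq0 // coprimepZl ?invr_eq0 ?invrK //.
by rewrite coprimepZr ?invr_eq0 ?invrK // coprimep_div_gcd // monic_neq0.
Qed.

Lemma subleading_sub (R : nzRingType) (p r : {poly R}) :
  p \is monic -> (size r < (size p).-1)%N ->
  [/\ p - r \is monic, size (p - r) = size p & subleading (p - r) = subleading p].
Proof.
move=> mp rp; have rp' : (size (- r) < size p)%N.
  by rewrite size_polyN (leq_trans rp) // leq_pred.
have sz : size (p - r) = size p by rewrite size_polyDl.
split=> //; first by rewrite monicE lead_coefDl.
rewrite /subleading sz; case: ltnP => // p1; rewrite coefB.
by rewrite [r`_ _]nth_default ?subr0 //; move: rp p1; case: (size p) => [|[]].
Qed.

Lemma subleadingX (R : nzRingType) : subleading ('X : {poly R}) = 0.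
Proof. by rewrite /subleading size_polyX coefX. Qed.

Lemma subleading_map (F1 : fieldType) (R : nzRingType) (f : {rmorphism F1 -> R})
  (p : {poly F1}) : subleading (map_poly f p) = f (subleading p).
Proof. by rewrite /subleading size_map_poly coef_map rmorphMn. Qed.

(** The last clause matters most: the central potential enters the trace in the symmetric case only,
    which later separates the two mean roots. *)
Lemma path_poly_monic (R : nzRingType) (a : R) s n :
  [/\ path_poly a s n.+1 \is monic,
      (size (path_poly a s n) < size (path_poly a s n.+1))%N,
      size (path_poly a s n.+1) = (n + ~~ s).+1 &
      subleading (path_poly a s n.+1) = if s then 0 else - a].
Proof.
elim: n => [|n [m1 s1 sz1 sl1]].
  rewrite /path_poly /=; case: s; rewrite /path_start /path_next /=.
    by rewrite monic1 size_poly0 size_poly1 /subleading size_poly1 mulr0n.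
  rewrite monicXsubC size_XsubC /subleading size_XsubC /= coefB coefX coefC sub0r.
  split=> //; rewrite -polyC_natr; exact: leq_ltn_trans (size_polyC_leq1 _) _.
rewrite path_polySS; set f1 := path_poly a s n.+1 in m1 s1 sz1 sl1 *.
have mX : 'X * f1 \is monic by rewrite monicMl ?monicX.
have sX : size ('X * f1) = (size f1).+1.
  by rewrite size_monicM ?monicX ?monic_neq0 // size_polyX.
have [|m2 s2 sl2] := @subleading_sub _ ('X * f1) (path_poly a s n) mX.
  by rewrite sX.
split=> //; first by rewrite s2 sX.
  by rewrite s2 sX sz1 addSn.
by rewrite sl2 subleadingM ?monicX // subleadingX add0r.
Qed.

Lemma map_path_poly (R S : nzRingType) (f : {rmorphism R -> S}) (a : R) s n :
  map_poly f (path_poly a s n) = path_poly (f a) s n.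
Proof.
have [] : map_poly f (path_poly a s n) = path_poly (f a) s n /\
   map_poly f (path_poly a s n.+1) = path_poly (f a) s n.+1; last by [].
elim: n => [|n [IH0 IH1]].
  rewrite /path_poly /= /path_start /path_next; case: s.
    by rewrite rmorph0 rmorph1.
  by rewrite rmorph_nat rmorphB /= map_polyX map_polyC.
by split=> //; rewrite !path_polySS rmorphB rmorphM /= map_polyX IH0 IH1.
Qed.

Lemma path_poly_odd_const (R : nzRingType) (a b : R) n : path_poly a true n = path_poly b true n.
Proof. by []. Qed.

(** So the symmetric path polynomial is itself a pencil, with the central potential as parameter. *)
Lemma path_poly_linear (R : comNzRingType) (a : R) n :
  path_poly a false n = path_poly 0 false n - a *: path_poly 0 true n.
Proof.
have [] : path_poly a false n = path_poly 0 false n - a *: path_poly 0 true n /\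
  path_poly a false n.+1 = path_poly 0 false n.+1 - a *: path_poly 0 true n.+1; last by [].
elim: n => [|n [IH0 IH1]].
  rewrite /path_poly /= /path_start /path_next scaler0 !subr0.
  by rewrite -mul_polyC mulr1.
split=> //; rewrite !path_polySS IH0 IH1 -!mul_polyC; ring.
Qed.

(** The discrete Wronskian of two solutions of one recurrence is constant; being a unit here, it
    yields a Bezout identity. *)
Lemma path_poly_casoratian (R : comNzRingType) n :
  path_poly 0 false n * path_poly 0 true n.+1
    - path_poly 0 false n.+1 * path_poly 0 true n = 2%:R :> {poly R}.
Proof.
elim: n => [|n IHn]; first by rewrite /path_poly /= mulr0 subr0 mulr1.
by rewrite -IHn !path_polySS; ring.
Qed.

Lemma coprimep_path_poly_succ (F : fieldType) (a : F) n : (2%:R : F) != 0 ->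
  coprimep (path_poly a false n.+1) (path_poly a false n).
Proof.
move=> two; elim: n => [|n IHn].
  rewrite /path_poly /= /path_start -[2%:R]scaler_nat.
  by rewrite coprimepZr // coprimep1.
by rewrite path_polySS coprimep_sym coprimep_addl_mul -scaleN1r coprimepZr // oppr_eq0 oner_eq0.
Qed.

Section ReducedPencil.
Local Notation K0 := {fraction {poly rat}}.
Local Notation r0 := (constF (K := rat)).
Local Notation a0 := (FracField.tofrac ('X : {poly rat})).
Variables (C : closedFieldType) (f : {rmorphism rat -> C}) (x : C).
Hypothesis x_trans : ~ algebraicOver f x.
Variable j : {rmorphism K0 -> C}.
Hypothesis jE : forall p : {poly rat}, j (FracField.tofrac p) = (map_poly f p).[x].

(** The roots of the symmetric path polynomial are transcendental over [rat] by [pencil_root_trans],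
    hence none is a root of a rational polynomial. *)
Lemma coprimep_path_poly_rat (q : {poly rat}) n : q \is monic ->
  coprimep (path_poly a0 false n.+1) (map_poly r0 q).
Proof.
move=> mq; have pencilE : path_poly a0 false n.+1 =
    pencil (path_poly 0 false n.+1) (path_poly 0 true n.+1).
  by rewrite path_poly_linear /pencil !map_path_poly !rmorph0.
have cop : coprimep (path_poly (0 : rat) false n.+1) (path_poly 0 true n.+1).
  apply/Bezout_coprimepP.
  exists (path_poly 0 true n.+2, - path_poly 0 false n.+2) => /=.
  rewrite mulrC mulNr path_poly_casoratian -[2%:R]scaler_nat eqp_scale //.
rewrite -(coprimep_map j); apply/negPn/negP => ncop.
have [z] : exists z, root (gcdp (map_poly j (path_poly a0 false n.+1))
    (map_poly j (map_poly r0 q))) z by apply/closed_rootP.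
rewrite root_gcd pencilE => /andP [zp zq].
apply: (pencil_root_trans x_trans jE cop zp); exists q; first exact: monic_neq0.
move: zq; rewrite -map_poly_comp (_ : map_poly _ q = map_poly f q) //.
by apply: eq_map_poly => c /=; rewrite jE map_polyC hornerC.
Qed.

(** Lowest terms for the glued Schur complement, with [D] the cancelled factor. The form of the
    subleading coefficient has to survive the cancellation, and for this the two signs need
    different arguments. *)
Lemma reduced_pencil (phi q : {poly rat}) (s : bool) (m : nat) :
  phi \is monic -> q \is monic -> size phi = (size q).+1 ->
  exists D a b : {poly K0},
   [/\ D != 0,
       path_poly a0 s m.+1 * map_poly r0 phi - map_poly r0 q * path_poly a0 s m = D * a,
       map_poly r0 q * path_poly a0 s m.+1 = D * b,
       [/\ a \is monic, b \is monic, size a = (size b).+1 & coprimep a b] &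
       exists c : rat, subleading a = r0 c - (if s then 0 else a0)].
Proof.
move=> mphi mq sphi.
have [g [phi' [q' [[phiE qE mg mphi'] [mq' cop']]]]] := monic_reduction mphi mq.
have sphi' : size phi' = (size q').+1.
  have := sphi; rewrite phiE qE !size_monicM ?monic_neq0 //.
  have : (0 < size q')%N by rewrite size_poly_gt0 monic_neq0.
  have : (0 < size g)%N by rewrite size_poly_gt0 monic_neq0.
  apply: (_ : forall k l n, 0 < k -> 0 < l ->
      (k + n).-1 = (k + l).-1.+1 -> n = l.+1)%N.
  by clear; lia.
(* The subtracted product is smaller by at least two degrees, so it changes neither the leading nor
   the subleading coefficient. *)
have numer (R : comNzRingType) (r : {rmorphism rat -> R}) (t : R) :
    let F := path_poly t s in
    [/\ F m.+1 * map_poly r phi' - map_poly r q' * F m \is monic,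
        size (F m.+1 * map_poly r phi' - map_poly r q' * F m) =
          (size (map_poly r q' * F m.+1)).+1 &
        subleading (F m.+1 * map_poly r phi' - map_poly r q' * F m) =
          (if s then 0 else - t) + r (subleading phi')].
  move=> F; have [mF sF _ slF] := path_poly_monic t s m.
  have mrphi : map_poly r phi' \is monic by rewrite map_monic.
  have mrq : map_poly r q' \is monic by rewrite map_monic.
  have q'0 : (0 < size q')%N by rewrite size_poly_gt0 monic_neq0.
  have szM : size (F m.+1 * map_poly r phi') = (size (F m.+1) + size q')%N.
    by rewrite size_monicM ?monic_neq0 // size_map_poly sphi' addnS.
  have [||m1 s1 sl1] := @subleading_sub _ (F m.+1 * map_poly r phi') (map_poly r q' * F m).
  - by rewrite monicMl.
  - apply: (leq_ltn_trans (size_polyMleq _ _)); rewrite szM size_map_poly.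
    apply: (_ : forall k l n, 0 < k -> l < n -> (k + l).-1 < (n + k).-1)%N => //.
    by lia.
  split=> //.
    rewrite s1 szM size_monicM ?monic_neq0 // size_map_poly.
    apply: (_ : forall k l, 0 < k -> l + k = (k + l).-1.+1)%N => //.
    by lia.
  by rewrite sl1 subleadingM // slF subleading_map.
case: s numer => numer.
(* Antisymmetric case: the central potential is absent, so the remaining common factor [h] is
   removed over [rat] and the trace stays rational. *)
- have [ma sa sla] := numer rat idfun 0.
  rewrite !map_poly_id // in ma sa sla.
  set F := path_poly (0 : rat) true in ma sa sla.
  have [mF _ _ _] := path_poly_monic (0 : rat) true m.
  have mb : q' * F m.+1 \is monic by rewrite monicMl.
  have [h [a' [b' [[aE bE mh ma'] [mb' copab]]]]] := monic_reduction ma mb.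
  have FE n : path_poly a0 true n = map_poly r0 (F n).
    by rewrite map_path_poly; exact: path_poly_odd_const.
  exists (map_poly r0 (g * h)), (map_poly r0 a'), (map_poly r0 b'); split.
  + by rewrite map_poly_eq0 mulf_neq0 ?monic_neq0.
  + rewrite !FE -!rmorphM -rmorphB /=; congr map_poly.
    by rewrite -mulrA -aE phiE qE; ring.
  + by rewrite !FE -!rmorphM /=; congr map_poly; rewrite -mulrA -bE qE mulrA.
  + rewrite !map_monic !size_map_poly coprimep_map; split=> //.
    have hs : (0 < size h)%N by rewrite size_poly_gt0 monic_neq0.
    have bs : (0 < size b')%N by rewrite size_poly_gt0 monic_neq0.
    move: sa; rewrite aE bE !size_monicM ?monic_neq0 //.
    move: hs bs; apply: (_ : forall k l n, 0 < k -> 0 < l ->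
      (k + n).-1 = (k + l).-1.+1 -> n = l.+1)%N.
    by clear; lia.
  + by exists (subleading a'); rewrite subleading_map subr0.
(* Symmetric case: once [phi / q] is reduced nothing more cancels, so the trace keeps its term in
   [a0]. *)
- have [ma sa sla] := numer _ r0 a0.
  set F := path_poly a0 false in ma sa sla *.
  have [mF _ _ _] := path_poly_monic a0 false m.
  have mrq : map_poly r0 q' \is monic by rewrite map_monic.
  exists (map_poly r0 g),
    (F m.+1 * map_poly r0 phi' - map_poly r0 q' * F m), (map_poly r0 q' * F m.+1).
  split.
  + by rewrite map_poly_eq0 monic_neq0.
  + by rewrite phiE qE !rmorphM /=; ring.
  + by rewrite qE rmorphM /= mulrA.
  + split.
    - exact: ma.
    - by rewrite monicMl; [exact: mF|exact: mrq].
    - exact: sa.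
    have copFq : coprimep (F m.+1) (map_poly r0 q') by exact: coprimep_path_poly_rat.
    have copFF : coprimep (F m.+1) (F m).
      apply: coprimep_path_poly_succ.
      by rewrite -(rmorph_nat r0) fmorph_eq0.
    have coppq : coprimep (map_poly r0 phi') (map_poly r0 q') by rewrite coprimep_map.
    rewrite coprimepMr; apply/andP; split; rewrite coprimep_sym.
      have -> : F m.+1 * map_poly r0 phi' - map_poly r0 q' * F m =
        - F m * map_poly r0 q' + F m.+1 * map_poly r0 phi' by ring.
      by rewrite coprimep_addl_mul coprimepMr coprimep_sym copFq coprimep_sym coppq.
    have -> : F m.+1 * map_poly r0 phi' - map_poly r0 q' * F m =
      map_poly r0 phi' * F m.+1 + (- map_poly r0 q') * F m by ring.
    rewrite coprimep_addl_mul coprimepMr copFF andbT.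
    by rewrite -scaleN1r coprimepZr // oppr_eq0 oner_eq0.
  + by exists (subleading phi'); rewrite sla addrC.
Qed.
End ReducedPencil.

(** * Embedding the function fields of the two potentials in the complex numbers *)

Section ParameterFields.
Variables (R : realType) (Q Q' : R).
Local Notation C := R[i].
Local Notation "x %:C" := (real_complex R x).
Local Notation K0 := {fraction {poly rat}}.
Hypothesis QQ'_indep : alg_indep2 Q Q'.
Hypothesis Q'_trans : transcendental Q'.

Lemma ratr_complex (c : rat) : (ratr c : R)%:C = ratr c.
Proof. exact: fmorph_rat. Qed.

Lemma Q'_complex_trans : ~ algebraicOver (ratr : rat -> C) (Q'%:C).
Proof.
move=> [p p0 pQ]; apply: Q'_trans; exists p => //.
rewrite -(fmorph_root (real_complex R)) -map_poly_comp.
by rewrite (eq_map_poly (g := ratr)) // => c; exact: ratr_complex.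
Qed.

(** Two applications of the universal property of fractions. Transcendence of [Q'] gives injectivity
    for [j]; clearing denominators turns an equation of [Q] over the field of [Q'] into a polynomial
    relation between [Q] and [Q'], which independence excludes. *)
Lemma parameter_fields : exists (j : {rmorphism K0 -> C})
    (iota : {rmorphism {fraction {poly K0}} -> C}),
  [/\ forall p : {poly rat}, j (FracField.tofrac p) = (map_poly ratr p).[Q'%:C],
      ~ algebraicOver j (Q%:C) &
      forall p : {poly K0}, iota (FracField.tofrac p) = (map_poly j p).[Q%:C]].
Proof.
pose f := (horner_eval (Q'%:C) \o map_poly (ratr : rat -> C)) : {rmorphism {poly rat} -> C}.
have f_inj : injective f.
  apply: raddf_inj => p fp; apply/eqP/negPn/negP => p0; apply: Q'_complex_trans.
  by exists p => //; apply/rootP.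
have [j jE] := fraction_lift_exists f_inj.
have Q_trans : ~ algebraicOver j (Q%:C).
  move=> [p p0 /rootP pQ]; have [c c0 [h hE]] := clear_denominators p.
  have h0 : h = 0.
    apply: QQ'_indep; apply: (@complexI R); rewrite rmorph0.
    have : (map_poly j (map_poly (FracField.tofrac (R := {poly rat})) h)).[Q%:C] = 0.
      by rewrite -hE linearZ /= hornerZ pQ mulr0.
    rewrite -map_poly_comp => <-.
    rewrite (@horner_coef_wide _ (size h) (map_poly _ h)) ?size_poly //.
    rewrite [in RHS](horner_coef_wide _ (size_poly _ _)).
    rewrite horner_sum rmorph_sum; apply: eq_bigr => k _.
    rewrite -polyC_exp hornerM hornerC !coef_map /= jE rmorphM rmorphXn; congr (_ * _).
    rewrite -horner_map -map_poly_comp; congr (_.[_]).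
    by apply: eq_map_poly => c'; exact: ratr_complex.
  move/eqP: hE; rewrite h0 rmorph0 scaler_eq0 tofrac_eq0 (negPf c0) /=.
  exact/negP.
pose f2 := (horner_eval (Q%:C) \o map_poly j) : {rmorphism {poly K0} -> C}.
have f2_inj : injective f2.
  apply: raddf_inj => p fp; apply/eqP/negPn/negP => p0; apply: Q_trans.
  by exists p => //; apply/rootP.
have [iota iotaE] := fraction_lift_exists f2_inj.
by exists j, iota; split.
Qed.
End ParameterFields.

(** Comparing the coefficients of the parameter gives [m = n]; the constant terms then agree. *)
Lemma affine_mean_inj (K : fieldType) (al be : K) (m n : nat) :
  (forall k, (k%:R == 0 :> K) = (k == 0%N)) -> m != 0%N -> n != 0%N ->
  (constF al - FracField.tofrac 'X) / m%:R = (constF be - FracField.tofrac 'X) / n%:R ->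
  al = be.
Proof.
move=> natK m0 n0.
have natF k : (k%:R == 0 :> {fraction {poly K}}) = (k == 0%N).
  by rewrite -(rmorph_nat (constF (K := K))) fmorph_eq0 natK.
move/eqP; rewrite eqr_div ?natF // /constF -!rmorphB.
rewrite -!(rmorph_nat (FracField.tofrac (R := {poly K}))) -!rmorphM tofrac_eq.
rewrite !mulr_natr => /eqP E.
have E1 := congr1 (fun p : {poly K} => p`_1) E.
have E0 := congr1 (fun p : {poly K} => p`_0) E.
move: E1 E0; rewrite !coefMn !coefB !coefC !coefX /= !subr0 !sub0r.
rewrite !mulNrn => /oppr_inj mn.
have aux k l : (k <= l)%N -> k%:R = l%:R :> K -> k = l.
  move=> kl /esym/eqP; rewrite -subr_eq0 -natrB // natK subn_eq0 => lk.
  by apply/eqP; rewrite eqn_leq kl lk.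
have {mn} -> : m = n.
  by case: (leqP m n) => [/aux|/ltnW/aux h]; [apply|rewrite h].
move/eqP; rewrite -subr_eq0 -mulrnBl -mulr_natr mulf_eq0 natK (negPf n0) orbF.
by rewrite subr_eq0 => /eqP.
Qed.

(** * Integer relations between the roots of the two pencils *)

Section Relation.
Local Notation K0 := {fraction {poly rat}}.
Local Notation F := {fraction {poly K0}}.
Local Notation r0 := (constF (K := rat)).
Local Notation a0 := (FracField.tofrac ('X : {poly rat})).
Variables (C : closedFieldType) (x : C) (j : {rmorphism K0 -> C})
  (iota : {rmorphism F -> C}).
Hypothesis x_trans : ~ algebraicOver j x.
Hypothesis iotaE : forall p : {poly K0}, iota (FracField.tofrac p) = (map_poly j p).[x].
Variables (a b : bool -> {poly K0}) (c : bool -> rat).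
Hypotheses (ma : forall s, a s \is monic) (mb : forall s, b s \is monic)
  (sab : forall s, size (a s) = (size (b s)).+1)
  (cop : forall s, coprimep (a s) (b s))
  (sla : forall s, subleading (a s) = r0 (c s) - (if s then 0 else a0)).

Lemma pchar_fraction2 : [pchar F] =i pred0.
Proof.
move=> n; rewrite inE /=; apply/negP => /andP [pn].
rewrite -(rmorph_nat (constF (K := K0))) fmorph_eq0 -(rmorph_nat r0) fmorph_eq0.
by rewrite pnatr_eq0; case: n pn.
Qed.

Let P s := pencil (a s) (b s).

Let bgt0 s : (0 < size (b s))%N.
Proof. by rewrite size_poly_gt0 monic_neq0. Qed.

Let ablt s : (size (b s) < size (a s))%N. Proof. by rewrite sab. Qed.

Let agt1 s : (1 < size (a s))%N. Proof. by rewrite sab ltnS. Qed.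

Let mP s : P s \is monic. Proof. exact: pencil_monic. Qed.

Let subP s : subleading (P s) = constF (subleading (a s)) - FracField.tofrac 'X.
Proof. exact: subleading_pencil. Qed.

Let irrP s : irreducible_poly (P s).
Proof. exact: (pencil_irreducible x_trans iotaE (cop s) (ablt s) (agt1 s)). Qed.

Let mu s : F := (constF (subleading (a s)) - FracField.tofrac 'X) / (size (b s))%:R.

Let muE s : subleading (P s) / (size (P s)).-1%:R = mu s.
Proof. by rewrite subP size_pencil // sab. Qed.

Let natF0 n : (n%:R == 0 :> F) = (n == 0%N).
Proof. by have /pcharf0P := pchar_fraction2; exact. Qed.

Let natK0 n : (n%:R == 0 :> K0) = (n == 0%N).
Proof. by rewrite -(fmorph_eq0 (constF (K := K0))) rmorph_nat natF0. Qed.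

(** Equal means would force equal subleading coefficients of [a true] and [a false], but only the
    latter involves [a0]. *)
Let mu_neq : mu true != mu false.
Proof.
have n0 s : size (b s) != 0%N by rewrite -lt0n.
apply/negP => /eqP E.
have := affine_mean_inj natK0 (n0 true) (n0 false) E; rewrite !sla.
rewrite subr0 /constF -rmorphB => /eqP; rewrite tofrac_eq => /eqP E1.
have := congr1 (fun p : {poly rat} => p`_1) E1.
by rewrite coefB !coefC coefX /= sub0r => /eqP; rewrite eq_sym oppr_eq0 oner_eq0.
Qed.

(** After taking traces each root counts as the mean of its pencil. As the coefficients sum to zero,
    what remains is the difference of the two means times the sum over the antisymmetric indices. *)
Theorem pencil_relation (I : finType) (s : I -> bool) (z : I -> C) (l : I -> int) :
  (forall i, l i != 0 -> root (map_poly iota (P (s i))) (z i)) ->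
  \sum_i l i = 0 -> \sum_i z i *~ l i = 0 -> \sum_i l i *+ s i = 0.
Proof.
move=> Pz suml sumz.
have HP i : l i != 0 -> [/\ P (s i) \is monic, irreducible_poly (P (s i)) &
    root (map_poly iota (P (s i))) (z i)].
  by move=> /Pz rz; split; [exact: mP|exact: irrP|exact: rz].
have := trace_relation pchar_fraction2 HP sumz.
have -> : \sum_i (subleading (P (s i)) / (size (P (s i))).-1%:R) *~ l i =
    (mu true - mu false) *~ (\sum_i l i *+ s i) + mu false *~ (\sum_i l i).
  rewrite !raddf_sum -big_split /=; apply: eq_bigr => i _.
  rewrite muE; case: (s i).
    by rewrite mulr1n -mulrzDl subrK.
  by rewrite mulr0n mulr0z add0r.
rewrite suml mulr0z addr0 => /eqP; rewrite -mulrzr mulf_eq0 subr_eq0.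
rewrite (negPf mu_neq) /=.
case: (\sum_i _) => n; first by rewrite natF0 => /eqP ->.
by rewrite NegzE mulrNz oppr_eq0 natF0.
Qed.

(** A common root would give the relation [z - z = 0], with one term in each pencil, and the
    coefficient on the antisymmetric side would have to vanish. *)
Lemma pencil_no_common_root (z : C) :
  root (map_poly iota (P true)) z -> ~~ root (map_poly iota (P false)) z.
Proof.
move=> zt; apply/negP => zf.
have : \sum_(s : bool) (if s then 1 else - 1 : int) *+ s = 0.
  apply: (@pencil_relation _ id (fun=> z)).
  - by case=> _; [exact: zt|exact: zf].
  - by rewrite big_bool.
  - by rewrite big_bool /= mulr1z mulrN1z subrr.
by rewrite big_bool.
Qed.
End Relation.

Lemma map_adjmx (T : finType) (F R : pzRingType) (f : {rmorphism F -> R}) (G : sgraph T) :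
  map_mx f (adjmx F G) = adjmx R G.
Proof. by apply/matrixP => i k; rewrite !mxE rmorph_nat. Qed.

(** Working over [rat] keeps the polynomials of [G] free of both potentials. *)
Lemma cospectral_rat (R : realType) (T : finType) (G : sgraph T) (u v : T) :
  cospectral R G u v -> cospectral rat G u v.
Proof.
rewrite /cospectral -!(map_adjmx (ratr : {rmorphism rat -> R})) -!map_char_poly.
exact: map_poly_inj.
Qed.

Section GraphPencils.
Local Notation K0 := {fraction {poly rat}}.
Local Notation r0 := (constF (K := rat)).
Local Notation a0 := (FracField.tofrac ('X : {poly rat})).
Variables (C : closedFieldType) (f : {rmorphism rat -> C}) (x' : C).
Hypothesis x'_trans : ~ algebraicOver f x'.
Variable j : {rmorphism K0 -> C}.
Hypothesis jE : forall p : {poly rat}, j (FracField.tofrac p) = (map_poly f p).[x'].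

(** Without the potential at [u] and [v], the Schur complement on the signed pair is [a / b]. The
    factor [D] stays in the equations because [X] need not be divisible by it. *)
Lemma graph_pencil (T : finType) (G : sgraph T) (u v w : T) (m : nat)
    (p : (m.+1.*2.+1).-tuple T) :
  u \in vset G -> v \in vset G -> u != v -> cospectral rat G u v ->
  uniq p -> nth u p 0 = u -> nth u p m.+1.*2 = v -> nth u p m.+1 = w ->
  vset G :&: vset (path_graph p) = [set u; v]%SET ->
  forall s : bool, exists D a b : {poly K0},
   [/\ D != 0,
       [/\ a \is monic, b \is monic, size a = (size b).+1 & coprimep a b],
       exists c : rat, subleading a = r0 c - (if s then 0 else a0) &
       exists X : T -> {poly K0},
         [/\ forall x, x \notin vset G :|: vset (path_graph p) -> X x = 0,
             X u = D * b, X v = (-1) ^+ s * (D * b) &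
             forall x, 'X * X x
                - \sum_y ((adj G x y)%:R + (adj (path_graph p) x y)%:R) * X y
                - (x == w)%:R * a0%:P * X x = D * a * signed_pair _ u v s x]].
Proof.
move=> uG vG uv cosp p_uniq p0 pl pm meet s.
have szp : size p = m.+1.*2.+1 by rewrite size_tuple.
have [q [mq szq /(_ s) [Y [Yoff Yu Yv Yeq]]]] := cospectral_vectors uG vG uv cosp.
have [Z [Zoff Zu Zv Zeq]] := path_vectors a0 s p_uniq p0 pl pm.
have wp : w \in vset (path_graph p) by rewrite inE -pm mem_nth // szp; lia.
have wu : w != u by rewrite -pm -[X in _ != X]p0 nth_uniq ?szp //; lia.
have wv : w != v by rewrite -pm -pl nth_uniq ?szp //; lia.
have Y0off x : x \notin vset G -> map_poly r0 (Y x) = 0.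
  by move=> /Yoff ->; rewrite rmorph0.
have Y0v : map_poly r0 (Y v) = (-1) ^+ s * map_poly r0 (q s).
  by rewrite Yv rmorphM rmorphXn rmorphN1.
have Y0eq x : 'X * map_poly r0 (Y x) - \sum_y (adj G x y)%:R * map_poly r0 (Y y) =
    map_poly r0 (char_poly (adjmx rat G)) * signed_pair _ u v s x.
  have := congr1 (map_poly r0) (Yeq x).
  rewrite rmorphB !rmorphM /= map_polyX rmorph_sum /= => E.
  rewrite (eq_bigr (fun y => map_poly r0 ((adj G x y)%:R * Y y))) => [|y _].
    by rewrite E /signed_pair rmorphD rmorphM rmorphXn rmorphN1 !rmorph_nat.
  by rewrite rmorphM rmorph_nat.
have [X [Xoff Xu Xv Xeq]] := glued_vectors meet uv wp wu wv Y0off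
  (congr1 (map_poly r0) Yu) Y0v Y0eq Zoff Zu Zv Zeq.
have [|D [a [b [D0 aE bE props cE]]]] := @reduced_pencil _ _ _ x'_trans _ jE
  (char_poly (adjmx rat G)) (q s) s m (char_poly_monic _) (mq s).
  by rewrite size_char_poly szq.
exists D, a, b; split; [exact: D0|exact: props|exact: cE|].
exists X; split.
- exact: Xoff.
- by rewrite Xu bE.
- by rewrite Xv bE.
move=> x; rewrite Xeq -aE path_polySS; congr (_ * _); ring.
Qed.
End GraphPencils.

(** * The main theorem *)

Lemma entry_mx_on (T : finType) (R : pzRingType) (S : {set T}) (h : T -> T -> R) x y :
  entry (mx_on S h) x y = if (x \in S) && (y \in S) then h x y else 0.
Proof.
rewrite /entry.
have big1x (V : nmodType) (z : T) (g : 'I_#|S| -> V) (v : V) :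
    (forall i, enum_val i = z -> g i = v) ->
    \sum_(i | enum_val i == z) g i = if z \in S then v else 0.
  move=> gz; case: (boolP (z \in S)) => zS; last first.
    by rewrite big1 // => i /eqP iz; case/negP: zS; rewrite -iz enum_valP.
  rewrite (big_pred1 (enum_rank_in zS z)); first by rewrite gz ?enum_rankK_in.
  by move=> i; rewrite /= -[RHS](inj_eq enum_val_inj) enum_rankK_in.
rewrite (big1x _ x _ (if y \in S then h x y else 0)); first by case: (x \in S).
by move=> i ix; apply: big1x => k ky; rewrite mxE ix ky.
Qed.

Lemma sum_delta (R : pzSemiRingType) (I : finType) (h : I -> R) (y : I) :
  \sum_x (x == y)%:R * h x = h y.
Proof.
rewrite (bigD1 y) //= eqxx mul1r big1 ?addr0 // => x /negPf ->.
by rewrite mul0r.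
Qed.

Section FinalMatrix.
Variables (R : pzRingType) (T : finType) (G : sgraph T) (p : seq T) (u v w : T) (Q Q' : R).
Hypothesis wp : w \in vset (path_graph p).

Definition glued_entry (x y : T) : R :=
  (adj G x y)%:R + ((adj (path_graph p) x y)%:R + Q' * ((x == y) && (x == w))%:R)
    + Q * ((x == y) && ((x == u) || (x == v)))%:R.

Lemma glued_mxE (i k : 'I_#|vset G :|: vset (path_graph p)|) :
  (glue_mx (adjmx R G)
             (adjmx R (path_graph p)
                + Q' *: potential R (vset (path_graph p)) [set w]%SET)
        + Q *: potential R (vset G :|: vset (path_graph p)) [set u; v]%SET) i k =
  glued_entry (enum_val i) (enum_val k).
Proof.
rewrite /glued_entry !mxE !inE.
have -> : adjmx R (path_graph p) + Q' *: potential R (vset (path_graph p)) [set w]%SET =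
    mx_on (vset (path_graph p)) (fun x y =>
      (adj (path_graph p) x y)%:R + Q' * ((x == y) && (x == w))%:R).
  by apply/matrixP => a b; rewrite !mxE !inE.
rewrite /adjmx !entry_mx_on; congr (_ + _ + _).
  case: (boolP (adj G _ _)) => [/adj_vset -> //|_]; first by case: ifP.
set x := enum_val i; set y := enum_val k.
case: (boolP ((x \in vset (path_graph p)) && (y \in vset (path_graph p)))) => // xyp.
case: (boolP (adj _ _ _)) => [/adj_vset|_]; first by rewrite (negPf xyp).
case: (boolP ((x == y) && (x == w))) => [/andP [/eqP xy /eqP xw]|_].
  by move: xyp; rewrite -xy xw wp.
by rewrite mulr0 addr0.
Qed.
End FinalMatrix.

Lemma glued_entry_map (R S : pzRingType) (f : {rmorphism R -> S}) (T : finType)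
    (G : sgraph T) (p : seq T) (u v w x y : T) (Q Q' : R) :
  f (glued_entry G p u v w Q Q' x y) = glued_entry G p u v w (f Q) (f Q') x y.
Proof. by rewrite /glued_entry !rmorphD !rmorphM /= !rmorph_nat. Qed.

Lemma glued_entry_sum (R : comNzRingType) (T : finType)
    (G : sgraph T) (p : seq T) (u v w x : T) (Q Q' : R) (X : T -> {poly R}) :
  \sum_y (glued_entry G p u v w Q Q' x y)%:P * X y =
  \sum_y ((adj G x y)%:R + (adj (path_graph p) x y)%:R) * X y
    + (x == w)%:R * Q'%:P * X x + ((x == u) || (x == v))%:R * Q%:P * X x.
Proof.
have delta (c : bool) (q : R) : \sum_y (q * ((x == y) && c)%:R)%:P * X y =
    c%:R * q%:P * X x.
  rewrite -[RHS](sum_delta (fun y => c%:R * q%:P * X y)); apply: eq_bigr => y _.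
  rewrite eq_sym -mulnb natrM !polyCM !polyC_natr; ring.
rewrite -!delta -!big_split /=; apply: eq_bigr => y _.
by rewrite /glued_entry !polyCD !polyC_natr; ring.
Qed.

Theorem theorem4p13 (R : realType) (T : finType) (G : sgraph T) (u v : T)
    (u_in_G : u \in vset G) (v_in_G : v \in vset G) (u_neq_v : u != v)
    (uv_cospectral : cospectral R G u v)
    (k : nat) (k_ge3 : (3 <= k)%N) (k_odd : odd k)
    (p : k.-tuple T) (p_uniq : uniq p)
    (p_first : nth u p 0 = u) (p_last : nth u p k.-1 = v)
    (w : T) (w_center : w = nth u p k./2)
    (G_path_meet : vset G :&: vset (path_graph p) = [set u; v]%SET)
    (Q' Q : R) (Q'_trans : transcendental Q') (Q_trans : transcendental Q)
    (QQ'_indep : alg_indep2 Q Q') :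
  PGST (glue_mx (adjmx R G)
             (adjmx R (path_graph p)
                + Q' *: potential R (vset (path_graph p)) [set w]%SET)
        + Q *: potential R (vset G :|: vset (path_graph p)) [set u; v]%SET)
       u v.
Proof.
have [m km] : exists m, k = m.+1.*2.+1.
  by exists (k./2.-1); move: (odd_double_half k); rewrite k_odd; lia.
subst k; have szp : size p = m.+1.*2.+1 by rewrite size_tuple.
have pm : nth u p m.+1 = w by rewrite w_center /= uphalf_double.
have wp : w \in vset (path_graph p) by rewrite inE -pm mem_nth // szp; lia.
have [j [iota [jE Qt iotaE]]] := parameter_fields QQ'_indep Q'_trans.
have := graph_pencil (Q'_complex_trans Q'_trans) jE u_in_G v_in_G u_neq_v
  (cospectral_rat uv_cospectral) p_uniq p_first p_last pm G_path_meet.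
move=> /fin_all_exists [D /fin_all_exists [a /fin_all_exists [b H]]].
have D0 s : D s != 0 by case: (H s).
have ma s : a s \is monic by case: (H s) => _ [].
have mb s : b s \is monic by case: (H s) => _ [].
have sab s : size (a s) = (size (b s)).+1 by case: (H s) => _ [].
have cop s : coprimep (a s) (b s) by case: (H s) => _ [].
have cP s : exists c0 : rat, subleading (a s) =
    constF c0 - (if s then 0 else FracField.tofrac ('X : {poly rat})).
  by case: (H s).
have [c cE] := fin_all_exists cP.
have relation := pencil_relation Qt iotaE ma mb sab cop cE.
have no_common := pencil_no_common_root Qt iotaE ma mb sab cop cE.
set S := vset G :|: vset (path_graph p).
set N : 'M[R]_#|S| := (X in PGST X).
have uS : u \in S by rewrite inE u_in_G.
have vS : v \in S by rewrite inE v_in_G.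
pose iu := enum_rank_in uS u; pose iv := enum_rank_in uS v.
have iuE : enum_val iu = u by rewrite enum_rankK_in.
have ivE : enum_val iv = v by rewrite enum_rankK_in.
have NE i l : N i l = glued_entry G p u v w Q Q' (enum_val i) (enum_val l).
  exact: glued_mxE.
have Nsym : N^T = N.
  apply/matrixP => i l; rewrite mxE !NE /glued_entry (adj_sym G) (adj_sym (path_graph p)).
  by rewrite [enum_val l == _]eq_sym; case: eqP => // ->.
rewrite -iuE -ivE; apply: PGST_criterion => // P lam eig orth.
pose P_C s := map_poly iota (pencil (a s) (b s)).
(* An eigenvector whose eigenvalue is not a root of the pencil is orthogonal to the corresponding
   signed pair. *)
have eigenroot s i : ~~ root (P_C s) ((lam i)%:C)%C -> P i iu + (-1) ^+ s * P i iv = 0.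
  move=> nroot; have [_ _ _ [X [Xoff Xu Xv Xeq]]] := H s.
  pose X1 y := map_poly j (X y).
  have X1off y : y \notin S -> X1 y = 0 by move=> /Xoff; rewrite /X1 => ->; rewrite rmorph0.
  pose beta (l : 'I_#|S|) : R[i] := signed_pair _ u v s (enum_val l).
  have X1u : X1 u = map_poly j (D s) * map_poly j (b s) by rewrite /X1 Xu rmorphM.
  have X1v : X1 v = (-1) ^+ s * (map_poly j (D s) * map_poly j (b s)).
    by rewrite /X1 Xv !rmorphM rmorphXn rmorphN1.
  have X1eq x : 'X * X1 x
      - \sum_y ((adj G x y)%:R + (adj (path_graph p) x y)%:R) * X1 y
      - (x == w)%:R * ((Q'%:C)%C)%:P * X1 x =
      map_poly j (D s) * map_poly j (a s) * signed_pair _ u v s x.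
    have := congr1 (map_poly j) (Xeq x).
    rewrite !rmorphB !rmorphM /= map_polyX rmorph_nat map_polyC /= jE map_polyX hornerX.
    rewrite rmorph_sum /= => E.
    rewrite (eq_bigr (fun y => map_poly j
      (((adj G x y)%:R + (adj (path_graph p) x y)%:R) * X y))) => [|y _].
      by rewrite E /signed_pair rmorphD rmorphM rmorphXn rmorphN1 !rmorph_nat.
    by rewrite rmorphM rmorphD !rmorph_nat.
  have betaE l : beta l = (l == iu)%:R + (-1) ^+ s * (l == iv)%:R.
    by rewrite /beta /signed_pair -iuE -ivE !(inj_eq enum_val_inj).
  have spu : signed_pair R[i] u v s u = 1.
    by rewrite /signed_pair eqxx (negPf u_neq_v) mulr0 addr0.
  have spv : signed_pair R[i] u v s v = (-1) ^+ s.
    by rewrite /signed_pair eqxx eq_sym (negPf u_neq_v) mulr1 add0r.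
  (* The factor 2 in the numerator arises because [u] and [v] contribute equally to the pairing with
     the signed pair, the sign being squared. *)
  have := @eigenvector_orthogonal _ _ (map_mx (real_complex R) N) P
    (fun i => ((lam i)%:C)%C) beta (fun l => X1 (enum_val l)) (map_poly j (D s))
    (P_C s) (2%:R * map_poly j (b s)) _ orth _ _ _ i nroot.
  rewrite (eq_bigr (fun l => (l == iu)%:R * P i l + (l == iv)%:R * ((-1) ^+ s * P i l))).
    rewrite big_split /= !sum_delta; apply.
    - by move=> i' l'; rewrite -eig; apply: eq_bigr => k' _; rewrite mxE.
    - by rewrite map_poly_eq0 D0.
    - move=> l; set x := enum_val l.
      rewrite (eq_bigr (fun l' => (glued_entry G p u v w (Q%:C)%C (Q'%:C)%C x
          (enum_val l'))%:P * X1 (enum_val l'))) => [|l' _]; last first.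
        by rewrite mxE NE (glued_entry_map (real_complex R)).
      rewrite -(@sum_enum_val _ _ S (fun y => (glued_entry G p u v w (Q%:C)%C (Q'%:C)%C x
          y)%:P * X1 y)) => [|y /X1off ->]; last by rewrite mulr0.
      rewrite glued_entry_sum /P_C (map_pencil iotaE) /beta -/x.
      have spE : (signed_pair R[i] u v s x)%:P = signed_pair {poly R[i]} u v s x.
        by rewrite /signed_pair polyCD polyCM rmorphXn rmorphN1 !polyC_natr.
      (* The potential [Q] acts only on [u] and [v], where [X1] is the image of [D * b] times the
         signed pair; so it turns [a] into [a - Q b], the specialized pencil. *)
      have QE : ((x == u) || (x == v))%:R * ((Q%:C)%C)%:P * X1 x =
          ((Q%:C)%C)%:P * (map_poly j (D s) * map_poly j (b s)) *
          (signed_pair R[i] u v s x)%:P.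
        have [->|xu] := eqVneq x u; first by rewrite spu X1u /=; ring.
        have [->|xv] := eqVneq x v.
          by rewrite spv X1v rmorphXn rmorphN1 /=; ring.
        by rewrite /signed_pair (negPf xu) (negPf xv) /= mulr0 addr0; ring.
      rewrite QE !opprD !addrA X1eq -spE -mul_polyC; ring.
    rewrite (eq_bigr (fun l => (l == iu)%:R * X1 (enum_val l) +
        (l == iv)%:R * ((-1) ^+ s * X1 (enum_val l)))) => [|l _]; last first.
      have -> : (beta l)^* = beta l.
        by rewrite betaE rmorphD rmorphM rmorphXn rmorphN1 !rmorph_nat.
      rewrite betaE polyCD polyCM rmorphXn rmorphN1 !polyC_natr; ring.
    rewrite big_split /= !sum_delta iuE ivE X1u X1v mulrA -expr2 sqrr_sign; ring.
  by move=> l _; rewrite betaE; ring.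
pose s i := P i iu + P i iv == 0.
(* Otherwise [eigenroot] would give the relation of the opposite symmetry: it contradicts the
   definition of [s i], or, combined with antisymmetry, makes the entry at [u] vanish. *)
have rootP_ i : P i iu != 0 -> root (P_C (s i)) ((lam i)%:C)%C.
  move=> Pi; apply/negPn/negP => /eigenroot; rewrite /s; case: eqP => [/eqP|E] /=.
    rewrite addr_eq0 => /eqP E; rewrite expr1 mulN1r -E -mulr2n => /eqP.
    by rewrite mulrn_eq0 /= (negPf Pi).
  by rewrite expr0 mul1r.
exists s; split=> [i|l lP suml sumlam].
  rewrite /s; case: eqP => [/eqP|/eqP E].
    by rewrite addr_eq0 => /eqP ->; rewrite expr1 mulN1r opprK.
  (* If neither the sum nor the difference of the two entries vanished, the eigenvalue would be a
     root of both pencils. *)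
  apply/eqP; rewrite expr0 mul1r eq_sym -subr_eq0; apply/negPn/negP => E'.
  have rf : root (P_C false) ((lam i)%:C)%C.
    by apply/negPn/negP => /eigenroot; rewrite expr0 mul1r; exact/eqP.
  have rt : root (P_C true) ((lam i)%:C)%C.
    by apply/negPn/negP => /eigenroot; rewrite expr1 mulN1r; exact/eqP.
  by have := no_common _ rt; rewrite rf.
apply: (relation _ s (fun i => ((lam i)%:C)%C)) => //.
  by move=> i /lP; exact: rootP_.
apply: etrans (_ : real_complex R (\sum_i lam i *~ l i) = 0); last first.
  by rewrite sumlam rmorph0.
by rewrite rmorph_sum; apply: eq_bigr => i _; rewrite rmorphMz.
Qed.
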